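(* Let $a>b>0$, let $\mathcal{E}:\ \frac{\mathsf{x}^2}{a}+\frac{\mathsf{y}^2}{b}=1$, and let $\mathcal{C}_{\lambda_0}$, $\lambda_0\in(0,b)\cup(b,a)$, be a conic confocal with $\mathcal{E}$. Let $n\ge3$ be an integer. The billiard trajectories within $\mathcal{E}$ with caustic $\mathcal{C}_{\lambda_0}$ are $n$-periodic if and only if there exists a pair of real polynomials $p_{d_1}$, $q_{d_2}$ of degrees $d_1$, $d_2$ respectively, satisfying the following: (a) if $n=2m$ is even, then $d_1=m$, $d_2=m-2$, and $$p_m^2(s)-s\left(s-\frac1a\right)\left(s-\frac1b\right)\left(s-\frac1{\lambda_0}\right)q_{m-2}^2(s)=1;$$ (b) if $n=2m+1$ is odd, then $d_1=m$, $d_2=m-1$, and $$\left(s-\frac1{\lambda_0}\right)p_m^2(s)-s\left(s-\frac1a\right)\left(s-\frac1b\right)q_{m-1}^2(s)=-1.$$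
   Context: The confocal family is $\mathcal{C}_{\lambda}:\ \frac{\mathsf{x}^2}{a-\lambda}+\frac{\mathsf{y}^2}{b-\lambda}=1$; $\mathcal{C}_\lambda$ is an ellipse for $\lambda<b$ and a hyperbola for $\lambda\in(b,a)$. A billiard trajectory within $\mathcal{E}$ is a polygonal line with vertices on $\mathcal{E}$ obeying the reflection law (angle of incidence equals angle of reflection) at each vertex; it has caustic $\mathcal{C}_{\lambda_0}$ if all lines containing its segments are tangent to $\mathcal{C}_{\lambda_0}$. A trajectory is $n$-periodic if it closes after $n$ reflections ($n$ is not required to be minimal); by Poncelet's theorem this property depends only on the caustic. *)

(* Defs.v *)
From mathcomp Require Import all_boot all_order all_algebra.
From mathcomp Require Import reals.

Set Implicit Arguments.
Unset Strict Implicit.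
Unset Printing Implicit Defensive.

Import Order.TTheory GRing.Theory Num.Theory.
Local Open Scope ring_scope.

(* Points and vectors of the Euclidean plane are pairs R * R, with an explicit
   Euclidean inner product: the library norm on products is the sup norm. *)
Definition dot (R : realType) (u v : R * R) : R := u.1 * v.1 + u.2 * v.2.

Definition unit_dir (R : realType) (P Q : R * R) : R * R :=
  let u := Q - P in
  let d := Num.sqrt (dot u u) in
  (u.1 / d, u.2 / d).

(* The reflection fixing nu and negating the vectors orthogonal to nu. *)
Definition mirror (R : realType) (nu u : R * R) : R * R :=
  let c := 2 * dot u nu / dot nu nu in
  (c * nu.1 - u.1, c * nu.2 - u.2).

Definition on_ellipse (R : realType) (a b : R) (P : R * R) : Prop :=
  P.1 ^+ 2 / a + P.2 ^+ 2 / b = 1.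

(* Half the gradient of x^2/a + y^2/b at P. *)
Definition ellipse_normal (R : realType) (a b : R) (P : R * R) : R * R :=
  (P.1 / a, P.2 / b).

(* Angle of incidence = angle of reflection at Q for the segments PQ and QS:
   the rays from Q to P and from Q to S make equal angles with the normal, on
   opposite sides of it (when PQ is along the normal, so is QS). *)
Definition reflects_at (R : realType) (a b : R) (P Q S : R * R) : Prop :=
  unit_dir Q S = mirror (ellipse_normal a b Q) (unit_dir Q P).

(* The polygonal line is indexed by int, so that the reflection law holds at
   every vertex. *)
Definition billiard_trajectory (R : realType) (a b : R) (P : int -> R * R)
    : Prop :=
  [/\ forall k, on_ellipse a b (P k),
      forall k, P k != P (k + 1) &
      forall k, reflects_at a b (P (k - 1)) (P k) (P (k + 1))].

(* For P <> Q, the line PQ is tangent to the conic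
   x^2/(a - l) + y^2/(b - l) = 1: it is the tangent line at some point
   (X : Y : Z) of its projective closure. Points at infinity (Z = 0) make the
   asymptotes of a hyperbola tangent to it. *)
Definition tangent_to_confocal (R : realType) (a b l : R) (P Q : R * R)
    : Prop :=
  exists X Y Z : R,
    let on_tangent (T : R * R) := X * T.1 / (a - l) + Y * T.2 / (b - l) = Z in
    [/\ (X, Y, Z) != (0, 0, 0),
        X ^+ 2 / (a - l) + Y ^+ 2 / (b - l) = Z ^+ 2,
        on_tangent P & on_tangent Q].

Definition has_caustic (R : realType) (a b l : R) (P : int -> R * R) : Prop :=
  forall k, tangent_to_confocal a b l (P k) (P (k + 1)).

Definition periodic_trajectory (R : realType) (n : nat) (P : int -> R * R)
    : Prop :=
  forall k, P (k + n%:Z) = P k.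

(* Main.v *)
(* At a vertex x with outgoing unit velocity v put, with s = 1/lambda,
   L(s) = (a s - 1)(b s - 1) [[- Q(x, v), Q(x, x) - 1], [- Q(v, v), Q(x, v)]],
   Q(u, w) = u1 w1 / (a - lambda) + u2 w2 / (b - lambda).  A flight of length t
   followed by a kick v += r (x1 / a, x2 / b) conjugates L by
   M = [[1, t], [r s, 1 + r t s]], L^2 = D with
   D = s (a s - 1)(b s - 1)(l0 s - 1), and at s = 1/a and s = 1/b the matrix M
   maps (x_i, v_i) to its value after the bounce.

   If a trajectory is n-periodic, the product T of n such matrices commutes with
   L, so T = P + Q L, where P^2 - D Q^2 = det T = 1 and P = 1 at 0, 1/a, 1/b.
   As P - 1 and P + 1 are coprime, each of them is, up to a constant, a square
   times a product of some of the linear factors of D; whether s - 1/l0 divides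
   P - 1 or P + 1 is decided by the parity of n = deg P, and the two square roots
   are p and q.

   Conversely P = 2 p^2 - 1 or P = - 2 (s - 1/l0) p^2 - 1 yields P + Q L of
   degree n; peeling off from the right the matrices M of any trajectory with the
   given caustic lowers its degree by one each time, because it intertwines the
   Lax matrices, and after n steps leaves a matrix with first row (1, 0).  The
   value at 1/a and 1/b then says that the n-th vertex is the initial one. *)
Require Import Defs.
From mathcomp Require Import all_boot all_order all_algebra.
From mathcomp Require Import reals ring lra zify.

Set Implicit Arguments.
Unset Strict Implicit.
Unset Printing Implicit Defensive.

Import Order.TTheory GRing.Theory Num.Theory.
Local Open Scope ring_scope.

(** * Polynomials and Pell equations *)

Lemma coefM_top (R : nzRingType) (p q : {poly R}) (m k : nat) :
  (size p <= m.+1)%N -> (size q <= k.+1)%N -> (p * q)`_(m + k) = p`_m * q`_k.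
Proof.
move=> sp sq; rewrite coefM.
have hm : (m < (m + k).+1)%N by rewrite ltnS leq_addr.
rewrite (bigD1 (Ordinal hm)) //= addKn big1 ?addr0 // => i.
rewrite -val_eqE /= => neim; case: (ltnP m i) => [mi|im].
  by rewrite nth_default ?mul0r // (leq_trans sp).
have {neim im} im : (i < m)%N by rewrite ltn_neqAle neim.
rewrite [q`__]nth_default ?mulr0 //; apply: (leq_trans sq).
by rewrite ltn_subRL ltn_add2r.
Qed.

Lemma size_le_pred (R : nzRingType) (p : {poly R}) (m : nat) :
  (size p <= m.+1)%N -> p`_m = 0 -> (size p <= m)%N.
Proof.
move=> /leq_sizeP sp p0; apply/leq_sizeP => j; rewrite leq_eqVlt.
by case/predU1P => [<-//|/sp].
Qed.

(** With [g = gcd(u, w)], [u = u1 g], [w = w1 g], one gets [u1 v = w1^2 g]. Then [u1 | g] because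
    [u1] and [w1] are coprime, and [g | u1] because [g] and [v] are. *)
Lemma coprimep_mul_eq_sqr (F : fieldType) (u v w : {poly F}) :
  coprimep u v -> u * v = w ^+ 2 -> w != 0 ->
  exists (c : F) (g : {poly F}), c != 0 /\ u = c *: g ^+ 2.
Proof.
move=> cuv uvw w0; pose g := gcdp u w.
have g0 : g != 0 by rewrite gcdp_eq0 negb_and w0 orbT.
have [u1 eu] : exists u1, u = u1 * g.
  by exists (u %/ g); rewrite divpK // dvdp_gcdl.
have [w1 ew] : exists w1, w = w1 * g.
  by exists (w %/ g); rewrite divpK // dvdp_gcdr.
have cu1w1 : coprimep u1 w1.
  have := @coprimep_div_gcd _ u w; rewrite w0 orbT => /(_ isT).
  by rewrite -/g {1}eu {1}ew !mulpK.
have e1 : u1 * v = w1 ^+ 2 * g.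
  apply: (mulIf g0); have := uvw; rewrite {1}eu ew => e.
  transitivity (u1 * g * v); first by ring.
  by rewrite e; ring.
have u1g : u1 %| g.
  rewrite -(@Gauss_dvdpr _ _ (w1 ^+ 2)); last exact: coprimep_expr.
  by rewrite -e1 dvdp_mulr.
have gu1 : g %| u1.
  rewrite -(@Gauss_dvdpl _ _ v) ?e1 ?dvdp_mull //.
  by apply: coprimep_dvdr cuv; apply: dvdp_gcdl.
have /eqpP[[c1 c2] /= /andP[c10 c20] e2] : u1 %= g by rewrite /eqp u1g gu1.
exists (c1^-1 * c2), g; split; first by rewrite mulf_neq0 ?invr_eq0.
by rewrite -scalerA expr2 scalerAl -e2 -scalerAl scalerA mulVf // scale1r.
Qed.

(** As [(P + 1) - (P - 1) = 2], [u] and [v] are coprime, hence squares up to constants [c] and [e].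
    These have the same sign, since [P - 1] and [P + 1] share their leading coefficient, and
    evaluation at 0 shows that it is the sign of [D2.[0]]. The size equations express
    [deg D2 + 2 deg p = n] and [deg D1 + 2 deg q = n]. *)
Lemma pell_split (R : rcfType) (n : nat) (P D1 D2 u v w : {poly R}) :
  (0 < n)%N -> size P = n.+1 -> P.[0] = 1 ->
  P - 1 = D1 * u -> P + 1 = D2 * v -> u * v = w ^+ 2 ->
  D1 \is monic -> D2 \is monic ->
  exists p q : {poly R},
    [/\ (size D2 + (size p).*2 = n.+3)%N, (size D1 + (size q).*2 = n.+3)%N &
        D2 * p ^+ 2 - D1 * q ^+ 2 = (Num.sg D2.[0])%:P].
Proof.
move=> n0 sP P0 eu ev uvw mD1 mD2.
have s1 : (size (1%R : {poly R}) < size P)%N by rewrite sP size_poly1 ltnS.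
have sN1 : (size (- 1 : {poly R})%R < size P)%N by rewrite size_polyN.
have sPm : size (P - 1) = n.+1 by rewrite size_polyDl.
have sPp : size (P + 1) = n.+1 by rewrite size_polyDl.
have u0 : u != 0.
  by apply/eqP => u0; move: sPm; rewrite eu u0 mulr0 size_poly0.
have v0 : v != 0.
  by apply/eqP => v0; move: sPp; rewrite ev v0 mulr0 size_poly0.
have w0 : w != 0 by rewrite -sqrf_eq0 -uvw mulf_neq0.
have cuv : coprimep u v.
  apply/Bezout_eq1_coprimepP; exists (- (2^-1)%:P * D1, (2^-1)%:P * D2) => /=.
  have e : (2^-1)%:P * 2 = 1 :> {poly R}.
    by rewrite -polyC_natr -polyCM mulVf ?pnatr_eq0.
  by rewrite -!mulrA -eu -ev -[RHS]e; ring.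
have [c [g [c0 eg]]] := coprimep_mul_eq_sqr cuv uvw w0.
have [e [h [e0 eh]]] : exists (e : R) (h : {poly R}), e != 0 /\ v = e *: h ^+ 2.
  by apply: (@coprimep_mul_eq_sqr _ _ u w); rewrite 1?coprimep_sym 1?mulrC.
have g0 : g != 0 by apply: contraNneq u0 => g0; rewrite eg g0 expr0n scaler0.
have h0 : h != 0 by apply: contraNneq v0 => h0; rewrite eh h0 expr0n scaler0.
have sz (D f : {poly R}) (k : R) : k != 0 -> f != 0 -> D \is monic ->
    size (D * (k *: f ^+ 2)) = n.+1 -> (size D + (size f).*2 = n.+3)%N.
  move=> k0 f0 mD; rewrite size_proper_mul ?size_scale ?expr2 ?size_mul //; last first.
    by rewrite (monicP mD) mul1r lead_coef_eq0 scaler_eq0 negb_or k0 mulf_neq0.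
  have := size_poly_gt0 f; have := size_poly_gt0 D.
  rewrite f0 (monic_neq0 mD); by case: (size D) (size f) => [|i] [|j] // _ _; lia.
have lc : e * lead_coef h ^+ 2 = c * lead_coef g ^+ 2.
  transitivity (lead_coef (P + 1)).
    by rewrite ev eh lead_coef_monicM // lead_coefZ lead_coef_exp.
  transitivity (lead_coef (P - 1)); first by rewrite !lead_coefDl.
  by rewrite eu eg lead_coef_monicM // lead_coefZ lead_coef_exp.
have e2 : e * (D2.[0] * h.[0] ^+ 2) = 2.
  have : (P + 1).[0] = 2 by rewrite !hornerE P0; ring.
  by rewrite ev eh hornerM hornerZ horner_exp => e2; rewrite -[RHS]e2; ring.
have sqr_pos (f : {poly R}) : f != 0 -> 0 < lead_coef f ^+ 2.
  by move=> f0; rewrite exprn_even_gt0 //= lead_coef_eq0.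
have sgc : Num.sg c = Num.sg e.
  have := congr1 Num.sg lc; rewrite [LHS]sgrM [RHS]sgrM.
  by rewrite (gtr0_sg (sqr_pos h h0)) (gtr0_sg (sqr_pos g g0)) !mulr1.
have h00 : h.[0] != 0.
  apply/eqP => h00; move: e2; rewrite h00 expr0n mulr0 mulr0.
  by move/eqP; rewrite eq_sym pnatr_eq0.
have sgD : Num.sg D2.[0] = Num.sg e.
  have := congr1 Num.sg e2; rewrite [LHS]sgrM [X in _ * X]sgrM.
  rewrite (@gtr0_sg _ (h.[0] ^+ 2)) ?exprn_even_gt0 //= (@gtr0_sg _ 2) // mulr1.
  have [en | ep | ee] := ltrgt0P e; rewrite ?(gtr0_sg en) ?(ltr0_sg ep).
  - by rewrite mul1r.
  - by rewrite mulN1r => /(canRL (@opprK _)).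
  - by rewrite ee eqxx in e0.
have sq (k : R) : Num.sqrt (`|k| / 2) ^+ 2 = Num.sg k * k / 2.
  by rewrite sqr_sqrtr ?divr_ge0 // -normrEsg.
have sc (k : R) : k != 0 -> Num.sqrt (`|k| / 2) != 0.
  by move=> k0; rewrite sqrtr_eq0 -ltNge divr_gt0 // normr_gt0.
(* This scaling gives [D2 p^2 = sg(e) (P + 1) / 2] and [D1 q^2 = sg(e) (P - 1) / 2]. *)
exists (Num.sqrt (`|e| / 2) *: h), (Num.sqrt (`|c| / 2) *: g); split.
- by rewrite size_scale ?sc //; apply: (sz _ _ e); rewrite // -eh -ev.
- by rewrite size_scale ?sc //; apply: (sz _ _ c); rewrite // -eg -eu.
rewrite !exprZn !sq sgc sgD.
transitivity ((Num.sg e / 2) *: (P + 1 - (P - 1))).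
  by rewrite ev eu eg eh -!mul_polyC; ring.
have -> : P + 1 - (P - 1) = 2%:P by rewrite polyC_natr; ring.
by rewrite -mul_polyC -polyCM; congr _%:P; field.
Qed.

Lemma pell_half (R : rcfType) (al be la : R) (n : nat) (P W : {poly R}) :
  0 < al -> 0 < be -> 0 < la -> al != be -> (3 <= n)%N -> size P = n.+1 ->
  P ^+ 2 - 1 = 'X * ('X - al%:P) * ('X - be%:P) * ('X - la%:P) * W ^+ 2 ->
  P.[0] = 1 -> P.[al] = 1 -> P.[be] = 1 ->
  exists p q : {poly R},
     (forall m : nat, n = (2 * m)%N ->
        [/\ size p = m.+1, size q = (m - 2).+1 &
            p ^+ 2
            - 'X * ('X - al%:P) * ('X - be%:P) * ('X - la%:P) * q ^+ 2 = 1])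
     /\
     (forall m : nat, n = (2 * m + 1)%N ->
        [/\ size p = m.+1, size q = (m - 1).+1 &
            ('X - la%:P) * p ^+ 2
            - 'X * ('X - al%:P) * ('X - be%:P) * q ^+ 2 = -1]).
Proof.
move=> al0 be0 la0 neab n3 sP ePW P0 Pa Pb.
have n0 : (0 < n)%N by apply: leq_trans n3.
have [U eU] : exists U, P - 1 = 'X * ('X - al%:P) * ('X - be%:P) * U.
  have : \prod_(z <- [:: 0; al; be]) ('X - z%:P) %| P - 1.
    apply: uniq_roots_dvdp; last first.
      rewrite uniq_rootsE /= !inE negb_or neab andbT.
      by rewrite ![0 == _]eq_sym !gt_eqF.
    by rewrite /= !rootE !hornerE P0 Pa Pb subrr eqxx.
  case/dvdpP => U; rewrite !big_cons big_nil subr0 => eU.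
  by exists U; rewrite eU; ring.
have mD : 'X * ('X - al%:P) * ('X - be%:P) \is @monic R.
  by rewrite !monicMl ?monicX ?monicXsubC.
have D0 := monic_neq0 mD.
have eUW : U * (P + 1) = ('X - la%:P) * W ^+ 2.
  apply: (mulfI D0); rewrite mulrA -eU [RHS]mulrA -ePW; ring.
have X0 : 'X - la%:P != 0 by rewrite polyXsubC_eq0.
have sD : size ('X * ('X - al%:P) * ('X - be%:P) : {poly R}) = 4%N.
  by rewrite !size_mul ?size_polyX ?size_XsubC ?mulf_neq0 ?polyX_eq0 ?polyXsubC_eq0.
(* Only the place of ['X - la%:P] is open. In the first case [D2 = 1] and [n] is even, in the second
   [D2 = 'X - la%:P] and [n] is odd; the size equations refute the other parity. *)
have rl : root U la || root (P + 1) la by rewrite -rootM eUW rootM root_XsubC eqxx.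
case/orP: rl => /factor_theorem [u eu].
- have euW : u * (P + 1) = W ^+ 2 by apply: (mulfI X0); rewrite -eUW eu; ring.
  have mD' : 'X * ('X - al%:P) * ('X - be%:P) * ('X - la%:P) \is @monic R.
    by rewrite monicMl ?monicXsubC.
  have eP : P - 1 = 'X * ('X - al%:P) * ('X - be%:P) * ('X - la%:P) * u.
    by rewrite eU eu; ring.
  have [p [q [sp sq epq]]] := pell_split n0 sP P0 eP (esym (mul1r _)) euW mD'
    (monic1 _).
  exists p, q; split => m nm; last by exfalso; move: sp; rewrite size_poly1; lia.
  move: sp sq; rewrite size_poly1 size_mul ?sD ?size_XsubC // => sp sq.
  split; [lia | lia |].
  by rewrite -[RHS]/(1%:P) -[p ^+ 2]mul1r epq hornerE sgr1.
- have euW : U * u = W ^+ 2 by apply: (mulfI X0); rewrite -eUW eu; ring.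
  have ePu : P + 1 = ('X - la%:P) * u by rewrite eu mulrC.
  have [p [q [sp sq epq]]] := pell_split n0 sP P0 eU ePu euW mD (monicXsubC _).
  move: sp sq; rewrite size_XsubC sD => sp sq.
  exists p, q; split => m nm; first by exfalso; lia.
  split; [lia | lia |].
  by rewrite epq !hornerE sgrN (gtr0_sg la0) polyCN.
Qed.

(** Put [P = 2 s D2 p^2 - 1] with [s] the right-hand side, 1 or -1. The Pell relation turns [P - 1]
    into [2 s D1 q^2], so [P] is 1 at the roots of [D1] and [W = 2 p q]. *)
Lemma pell_double (R : rcfType) (al be la : R) (n : nat) (p q : {poly R}) :
  (3 <= n)%N ->
  (forall m : nat, n = (2 * m)%N ->
     [/\ size p = m.+1, size q = (m - 2).+1 &
         p ^+ 2
         - 'X * ('X - al%:P) * ('X - be%:P) * ('X - la%:P) * q ^+ 2 = 1]) ->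
  (forall m : nat, n = (2 * m + 1)%N ->
     [/\ size p = m.+1, size q = (m - 1).+1 &
         ('X - la%:P) * p ^+ 2
         - 'X * ('X - al%:P) * ('X - be%:P) * q ^+ 2 = -1]) ->
  exists P W : {poly R},
    [/\ size P = n.+1, size W = n.-1,
        P ^+ 2 - 1 = 'X * ('X - al%:P) * ('X - be%:P) * ('X - la%:P) * W ^+ 2,
        P.[0] = 1 & P.[al] = 1 /\ P.[be] = 1].
Proof.
move=> n3 hev hodd.
have two0 : 2 != 0 :> R by rewrite pnatr_eq0.
have mtwo0 : - 2 != 0 :> R by rewrite oppr_eq0.
have E (D1 D2 : {poly R}) (s : R) : s ^+ 2 = 1 ->
    D2 * p ^+ 2 - D1 * q ^+ 2 = s%:P ->
    ((2 * s) *: (D2 * p ^+ 2) - 1) ^+ 2 - 1 = D1 * D2 * (2 *: (p * q)) ^+ 2.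
  move=> s1 e; have ss : s%:P * s%:P = 1 :> {poly R} by rewrite -polyCM -expr2 s1.
  have -> : D1 * D2 * (2 *: (p * q)) ^+ 2 =
      4 * (D2 * p ^+ 2) * (D2 * p ^+ 2 - (D2 * p ^+ 2 - D1 * q ^+ 2)).
    by rewrite -mul_polyC; ring.
  by rewrite e -mul_polyC; ring: ss.
have V (D1 D2 : {poly R}) (s z : R) : s ^+ 2 = 1 ->
    D2 * p ^+ 2 - D1 * q ^+ 2 = s%:P -> D1.[z] = 0 ->
    ((2 * s) *: (D2 * p ^+ 2) - 1).[z] = 1.
  move=> s1 e D1z; have := congr1 (horner^~ z) e.
  rewrite hornerD hornerN [(D1 * _).[z]]hornerM D1z mul0r subr0 hornerC => ez.
  rewrite hornerD hornerN hornerZ ez hornerC -mulrA -expr2 s1; ring.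
have sq1 : (size (- 1 : {poly R})%R = 1)%N by rewrite size_polyN size_poly1.
case: (boolP (odd n)) => [on | en].
- have nm : n = (2 * n./2 + 1)%N by have := odd_double_half n; rewrite on; lia.
  have [sp sq e] := hodd _ nm.
  have p0 : p != 0 by rewrite -size_poly_gt0 sp.
  have q0 : q != 0 by rewrite -size_poly_gt0 sq.
  have X0 : 'X - la%:P != 0 :> {poly R} by rewrite polyXsubC_eq0.
  have m1 : (-1) ^+ 2 = 1 :> R by rewrite sqrrN expr1n.
  have e' : ('X - la%:P) * p ^+ 2 - 'X * ('X - al%:P) * ('X - be%:P) * q ^+ 2
     = (-1)%:P by rewrite e polyCN.
  exists ((2 * -1) *: (('X - la%:P) * p ^+ 2) - 1), (2 *: (p * q)); split.
  + have s2 : size ((2 * -1) *: (('X - la%:P) * p ^+ 2)) = n.+1.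
      rewrite mulrN1 size_scale // expr2 !size_mul ?mulf_neq0 // size_XsubC sp; lia.
    by rewrite size_polyDl s2 // sq1; lia.
  + by rewrite size_scale // size_mul // sp sq; lia.
  + by rewrite (E _ _ _ m1 e').
  + by apply: (V _ _ _ _ m1 e'); rewrite !hornerE.
  + by split; apply: (V _ _ _ _ m1 e'); rewrite !hornerE; ring.
- have nm : n = (2 * n./2)%N by have := odd_double_half n; rewrite (negPf en); lia.
  have [sp sq e] := hev _ nm.
  have p0 : p != 0 by rewrite -size_poly_gt0 sp.
  have q0 : q != 0 by rewrite -size_poly_gt0 sq.
  have m1 : 1 ^+ 2 = 1 :> R by rewrite expr1n.
  have e' : 1 * p ^+ 2
     - 'X * ('X - al%:P) * ('X - be%:P) * ('X - la%:P) * q ^+ 2 = 1%:P.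
    by rewrite mul1r.
  exists ((2 * 1) *: (1 * p ^+ 2) - 1), (2 *: (p * q)); split.
  + have s2 : size ((2 * 1) *: (1 * p ^+ 2)) = n.+1.
      rewrite mulr1 mul1r size_scale // expr2 size_mul // sp; lia.
    by rewrite size_polyDl s2 // sq1; lia.
  + by rewrite size_scale // size_mul // sp sq; lia.
  + by rewrite (E _ _ _ m1 e') mulr1.
  + by apply: (V _ _ _ _ m1 e'); rewrite !hornerE.
  + by split; apply: (V _ _ _ _ m1 e'); rewrite !hornerE; ring.
Qed.

(** * The bounce map and its Lax matrix *)

(** A vertex with its outgoing velocity. The third equation fixes Joachimsthal's integral: its
    square encodes tangency to the confocal conic of parameter [l], and its sign makes the velocity
    point inwards. *)
Definition phase (R : rcfType) (a b l : R) (s : (R * R) * (R * R)) : Prop :=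
  [/\ b * s.1.1 ^+ 2 + a * s.1.2 ^+ 2 = a * b,
      s.2.1 ^+ 2 + s.2.2 ^+ 2 = 1 &
      b * s.1.1 * s.2.1 + a * s.1.2 * s.2.2 = - Num.sqrt (a * b * l)].

Definition quad_dir (R : rcfType) (a b : R) (v : R * R) : R :=
  b * v.1 ^+ 2 + a * v.2 ^+ 2.

(* On the ellipse this is a b |ellipse_normal a b x|^2. *)
Definition quad_pos (R : rcfType) (a b : R) (x : R * R) : R :=
  a + b - (x.1 ^+ 2 + x.2 ^+ 2).

(** The nonzero root [t] of the quadratic equation that puts [x + t v] on the ellipse. *)
Definition flight (R : rcfType) (a b l : R) (v : R * R) : R :=
  2 * Num.sqrt (a * b * l) / quad_dir a b v.

(** The coefficient [- 2 (u . n) / (n . n)] of the reflection of an arriving velocity [u] in the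
    tangent, [n] being the normal at [x]. *)
Definition kick (R : rcfType) (a b l : R) (x : R * R) : R :=
  - (2 * Num.sqrt (a * b * l) / quad_pos a b x).

Definition bounce (R : rcfType) (a b l : R) (s : (R * R) * (R * R)) :
    (R * R) * (R * R) :=
  let t := flight a b l s.2 in
  let x := (s.1.1 + t * s.2.1, s.1.2 + t * s.2.2) in
  let r := kick a b l x in
  (x, (s.2.1 + r * (x.1 / a), s.2.2 + r * (x.2 / b))).

Definition unbounce (R : rcfType) (a b l : R) (s : (R * R) * (R * R)) :
    (R * R) * (R * R) :=
  let r := kick a b l s.1 in
  let v := (s.2.1 - r * (s.1.1 / a), s.2.2 - r * (s.1.2 / b)) in
  let t := flight a b l v in
  ((s.1.1 - t * v.1, s.1.2 - t * v.2), v).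

Lemma unbounceK (R : rcfType) (a b l : R) :
  cancel (unbounce a b l) (bounce a b l).
Proof.
move=> [[x1 x2] [v1 v2]]; by rewrite /bounce /unbounce /= !subrK.
Qed.

Lemma quad_dir_gt0 (R : rcfType) (a b : R) (v : R * R) :
  0 < b -> b < a -> v.1 ^+ 2 + v.2 ^+ 2 = 1 -> 0 < quad_dir a b v.
Proof.
move=> b0 ba v1; rewrite /quad_dir.
have -> : b * v.1 ^+ 2 + a * v.2 ^+ 2 = b + (a - b) * v.2 ^+ 2.
  by rewrite -[X in _ = X + _]mulr1 -v1; ring.
by rewrite ltr_wpDr // mulr_ge0 ?sqr_ge0 // subr_ge0 ltW.
Qed.

Lemma quad_pos_gt0 (R : rcfType) (a b : R) (x : R * R) :
  0 < b -> b < a -> b * x.1 ^+ 2 + a * x.2 ^+ 2 = a * b -> 0 < quad_pos a b x.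
Proof.
move=> b0 ba ex; rewrite /quad_pos.
have a0 : 0 < a by apply: lt_trans ba.
rewrite -(pmulr_rgt0 _ a0).
have -> : a * (a + b - (x.1 ^+ 2 + x.2 ^+ 2)) = a ^+ 2 - (a - b) * x.1 ^+ 2.
  transitivity (a * a + a * b - a * x.1 ^+ 2 - a * x.2 ^+ 2); first by ring.
  by rewrite -ex; ring.
have h : b * x.1 ^+ 2 <= a * b by rewrite -ex lerDl mulr_ge0 ?sqr_ge0 // ltW.
have h' : x.1 ^+ 2 <= a by rewrite -(ler_pM2l b0) [b * a]mulrC.
have : (a - b) * x.1 ^+ 2 <= (a - b) * a by rewrite ler_wpM2l // subr_ge0 ltW.
by nra.
Qed.

(** The state between flight and kick: Joachimsthal's integral has changed sign. The last two
    equations define [t] and [r] without denominators. *)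
Lemma bounce_step (R : rcfType) (a b l : R) (s : (R * R) * (R * R)) :
  0 < b -> b < a -> phase a b l s ->
  let sg := Num.sqrt (a * b * l) in
  let t := flight a b l s.2 in let y := (bounce a b l s).1 in
  let r := kick a b l y in
  [/\ b * y.1 ^+ 2 + a * y.2 ^+ 2 = a * b, b * y.1 * s.2.1 + a * y.2 * s.2.2 = sg,
      t * quad_dir a b s.2 = 2 * sg & r * quad_pos a b y = - (2 * sg)].
Proof.
move=> b0 ba [e1 e2 e3] sg t y r.
have et : t * quad_dir a b s.2 = 2 * sg.
  by rewrite /t /flight divfK // gt_eqF // quad_dir_gt0.
have e4 : b * y.1 ^+ 2 + a * y.2 ^+ 2 = a * b.
  rewrite /y /= -/t.
  transitivity (b * s.1.1 ^+ 2 + a * s.1.2 ^+ 2 + t *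
    (2 * (b * s.1.1 * s.2.1 + a * s.1.2 * s.2.2) + t * quad_dir a b s.2)).
    by rewrite /quad_dir; ring.
  by rewrite e1 e3 et /sg; ring.
split => //.
- rewrite /y /= -/t.
  transitivity (b * s.1.1 * s.2.1 + a * s.1.2 * s.2.2 + t * quad_dir a b s.2).
    by rewrite /quad_dir; ring.
  by rewrite e3 et /sg; ring.
- by rewrite /r /kick mulNr divfK // gt_eqF // quad_pos_gt0.
Qed.

(** The relation on [r] makes the kick a reflection. With [r] free, the lemma serves [bounce] and,
    with the opposite coefficient, [unbounce]. *)
Lemma kick_phase (R : rcfType) (a b r : R) (x u : R * R) :
  a != 0 -> b != 0 ->
  b * x.1 ^+ 2 + a * x.2 ^+ 2 = a * b -> u.1 ^+ 2 + u.2 ^+ 2 = 1 ->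
  r * quad_pos a b x + 2 * (b * x.1 * u.1 + a * x.2 * u.2) = 0 ->
  let v := (u.1 + r * (x.1 / a), u.2 + r * (x.2 / b)) in
  [/\ v.1 ^+ 2 + v.2 ^+ 2 = 1,
      b * x.1 * v.1 + a * x.2 * v.2 = - (b * x.1 * u.1 + a * x.2 * u.2),
      x.1 * v.1 + x.2 * v.2 = x.1 * u.1 + x.2 * u.2 + r &
      quad_dir a b v = quad_dir a b u - 2 * r * (x.1 * u.1 + x.2 * u.2) - r ^+ 2].
Proof.
case: x u => [x1 x2] [u1 u2] a0 b0 /=; rewrite /quad_pos /quad_dir /=.
(* Passing from [x] to the normal [(y1, y2)] removes all divisions. *)
have [y1 ->] : exists y1, x1 = a * y1 by exists (x1 / a); rewrite mulrC divfK.
have [y2 ->] : exists y2, x2 = b * y2 by exists (x2 / b); rewrite mulrC divfK.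
rewrite ![_ * _ / _]mulrAC !divff // !mul1r => e1 e2 e3.
have ab0 : a * b != 0 by rewrite mulf_neq0.
have {}e1 : a * y1 ^+ 2 + b * y2 ^+ 2 = 1.
  by apply: (mulfI ab0); rewrite mulr1 -[RHS]e1; ring.
have {}e3 : r * (y1 ^+ 2 + y2 ^+ 2) + 2 * (y1 * u1 + y2 * u2) = 0.
  apply: (mulfI ab0); rewrite mulr0 -[RHS]e3.
  rewrite -[in RHS](mulr1 (a + b)) -e1; ring.
split.
- rewrite -e2 -[RHS]addr0 -[X in _ = _ + X](mulr0 r) -e3; ring.
- rewrite -[RHS]addr0 -[X in _ = _ + X](mulr0 (a * b)) -e3; ring.
- rewrite -[r in RHS]mulr1 -e1; ring.
- have -> : r ^+ 2 = r ^+ 2 * (a * y1 ^+ 2 + b * y2 ^+ 2) by rewrite e1 mulr1.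
  rewrite -[RHS]addr0 -[X in _ = _ + X](mulr0 (r * (a + b))) -e3; ring.
Qed.

Lemma sqrt_abl_sqr (R : rcfType) (a b l : R) :
  0 < a -> 0 < b -> 0 < l -> Num.sqrt (a * b * l) ^+ 2 = a * b * l.
Proof. by move=> a0 b0 l0; rewrite sqr_sqrtr // ltW // !mulr_gt0. Qed.

Lemma bounce_phase (R : rcfType) (a b l : R) (s : (R * R) * (R * R)) :
  0 < b -> b < a -> phase a b l s -> phase a b l (bounce a b l s).
Proof.
move=> b0 ba ps; have [e1 e2 e3 e4] := bounce_step b0 ba ps.
have a0 : 0 < a by apply: lt_trans ba.
case: (ps) => _ u1 _.
have [|f1 f2 _ _] := @kick_phase _ _ _ (kick a b l (bounce a b l s).1) _ _
  (lt0r_neq0 a0) (lt0r_neq0 b0) e1 u1; first by rewrite e2 e4; ring.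
by split; rewrite //= f2 e2.
Qed.

Lemma unbounce_phase (R : rcfType) (a b l : R) (s : (R * R) * (R * R)) :
  0 < b -> b < a -> phase a b l s -> phase a b l (unbounce a b l s).
Proof.
move=> b0 ba [e1 e2 e3]; have a0 : 0 < a by apply: lt_trans ba.
set s' := unbounce a b l s; set sg := Num.sqrt (a * b * l) in e3 *.
have er : kick a b l s.1 * quad_pos a b s.1 = - (2 * sg).
  by rewrite /kick mulNr divfK // gt_eqF // quad_pos_gt0.
have [|f1 f2 _ _] := @kick_phase _ _ _ (- kick a b l s.1) _ _ (lt0r_neq0 a0)
  (lt0r_neq0 b0) e1 e2; first by rewrite mulNr er e3 /sg; ring.
have ev : s'.2 = (s.2.1 + - kick a b l s.1 * (s.1.1 / a),
                  s.2.2 + - kick a b l s.1 * (s.1.2 / b)).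
  by rewrite /s' /= !mulNr.
rewrite -ev e3 opprK in f1 f2.
have -> : s' = let v := s'.2 in let t := flight a b l v in
  ((s.1.1 - t * v.1, s.1.2 - t * v.2), v) by [].
move: s'.2 f1 f2 {ev} => v f1 f2; set t := flight a b l v.
have et : t * quad_dir a b v = 2 * sg.
  by rewrite /t /flight divfK // gt_eqF // quad_dir_gt0.
split => //=.
- transitivity (b * s.1.1 ^+ 2 + a * s.1.2 ^+ 2 - t *
    (2 * (b * s.1.1 * v.1 + a * s.1.2 * v.2) - t * quad_dir a b v)).
    by rewrite /quad_dir /t; ring.
  by rewrite e1 f2 et /sg; ring.
- transitivity (b * s.1.1 * v.1 + a * s.1.2 * v.2 - t * quad_dir a b v).
    by rewrite /quad_dir /t; ring.
  by rewrite f2 et /sg; ring.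
Qed.

Definition inner (R : rcfType) (s : (R * R) * (R * R)) : R :=
  s.1.1 * s.2.1 + s.1.2 * s.2.2.

(* The entries of L = [[A, B], [C, - A]] when x is on the ellipse and v is a unit
   vector, with sg = - (b x1 v1 + a x2 v2), mu = x . v, k = quad_pos a b x and
   c = quad_dir a b v; sg changes sign at each flight and at each kick. *)
Definition laxA (R : rcfType) (sg mu : R) : {poly R} := sg *: 'X^2 + mu *: 'X.
Definition laxB (R : rcfType) (k : R) : {poly R} := k *: 'X - 1.
Definition laxC (R : rcfType) (c : R) : {poly R} := - c *: 'X^2 + 'X.

(** Conjugation by [M], entry by entry, through its two shears: [[[1, t], [0, 1]]] fixes [C], then
    [[[1, 0], [r X, 1]]] fixes [B1]. *)
Lemma lax_step (R : rcfType) (a b l : R) (s : (R * R) * (R * R)) :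
  0 < b -> b < a -> phase a b l s ->
  let sg := Num.sqrt (a * b * l) in
  let t := flight a b l s.2 in let s' := bounce a b l s in
  let r := kick a b l s'.1 in
  let A := laxA sg (inner s) in let B := laxB (quad_pos a b s.1) in
  let C := laxC (quad_dir a b s.2) in
  let A1 := laxA (- sg) (inner s + t) in let B1 := laxB (quad_pos a b s'.1) in
  [/\ A1 = A + t *: C, B1 = B - (2 * t) *: A - t ^+ 2 *: C,
      laxA sg (inner s') = A1 - r *: ('X * B1) &
      laxC (quad_dir a b s'.2) =
        C + (2 * r) *: ('X * A1) - r ^+ 2 *: ('X^2 * B1)].
Proof.
move=> b0 ba ps sg t s' r A B C A1 B1.
have [e1 e2 e3 e4] := bounce_step b0 ba ps; rewrite -/sg -/t -/s' -/r in e2 e3 e4.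
have a0 : 0 < a by apply: lt_trans ba.
case: (ps) => d1 u1 d3.
have [|_ _ f3 f4] := @kick_phase _ _ _ r _ _ (lt0r_neq0 a0) (lt0r_neq0 b0) e1 u1.
  by rewrite e2 e4 -/sg; ring.
have mu1 : s'.1.1 * s.2.1 + s'.1.2 * s.2.2 = inner s + t.
  transitivity (inner s + t * (s.2.1 ^+ 2 + s.2.2 ^+ 2)); last by rewrite u1 mulr1.
  by rewrite /s' /= -/t /inner; ring.
have kE : quad_pos a b s'.1 = quad_pos a b s.1 - 2 * t * inner s - t ^+ 2.
  transitivity (quad_pos a b s.1 - 2 * t * inner s -
    t ^+ 2 * (s.2.1 ^+ 2 + s.2.2 ^+ 2)); last by rewrite u1 mulr1.
  by rewrite /s' /= -/t /inner /quad_pos /=; ring.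
have muE : inner s' = inner s + t + r by rewrite -mu1 -f3.
have cE : quad_dir a b s'.2 = quad_dir a b s.2 - 2 * r * (inner s + t) - r ^+ 2.
  by rewrite -mu1 -f4.
(* These relations account for the change of sign of [sg] at the flight and back at the kick. *)
have p3 : t%:P * (quad_dir a b s.2)%:P = 2 * sg%:P.
  by rewrite -polyCM e3; ring.
have p4 : r%:P * (quad_pos a b s'.1)%:P = - (2 * sg%:P).
  by rewrite -polyCM e4; ring.
rewrite /A1 /B1 /A /B /C /laxA /laxB /laxC -!mul_polyC; split.
- by ring: p3.
- by rewrite kE; ring: p3.
- by rewrite muE; ring: p4.
- by rewrite cE; ring: p4.
Qed.

(** * Descent from a Pell solution to periodicity *)

Lemma size_laxA (R : rcfType) (sg mu : R) : (size (laxA sg mu) <= 3)%N.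
Proof.
apply/leq_sizeP => j j3; rewrite !coefE.
by case: j j3 => [|[|[|j]]] //= _; rewrite !mulr0 addr0.
Qed.

Lemma size_laxB (R : rcfType) (k : R) : (size (laxB k) <= 2)%N.
Proof.
apply/leq_sizeP => j j3; rewrite !coefE.
by case: j j3 => [|[|j]] //= _; rewrite mulr0 subr0.
Qed.

Lemma size_laxC (R : rcfType) (c : R) : (size (laxC c) <= 3)%N.
Proof.
apply/leq_sizeP => j j3; rewrite !coefE.
by case: j j3 => [|[|[|j]]] //= _; rewrite mulr0 addr0.
Qed.

Lemma coef_laxA2 (R : rcfType) (sg mu : R) : (laxA sg mu)`_2 = sg.
Proof. by rewrite !coefE /= mulr1 mulr0 addr0. Qed.

Lemma coef_laxB1 (R : rcfType) (k : R) : (laxB k)`_1 = k.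
Proof. by rewrite !coefE /= mulr1 subr0. Qed.

Lemma coef_laxC2 (R : rcfType) (c : R) : (laxC c)`_2 = - c.
Proof. by rewrite !coefE /= mulr1 addr0. Qed.

(* Multiplication of a row on the right by M^-1. *)
Definition row_back (R : rcfType) (t r : R) (u : {poly R} * {poly R}) :
    {poly R} * {poly R} :=
  let be := u.2 - t *: u.1 in (u.1 - r *: ('X * be), be).

Lemma size_scale_sub (R : rcfType) (m : nat) (p q : {poly R}) (t : R) :
  (size p <= m)%N -> (size q <= m)%N -> (size (p - t *: q)%R <= m)%N.
Proof.
move=> sp sq; rewrite (leq_trans (size_polyD _ _)) // geq_max sp size_polyN.
by rewrite (leq_trans (size_scale_leq _ _)).
Qed.

(** For [T = [[al, be], [ga, de]]] with [T L = L0 T], the lower left entry in degree [d + 3] shows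
    that the top coefficients of [de] and [ga] have ratio [t]; the determinant in degree [2 d + 1]
    carries this ratio over to [be] and [al]. Undoing the flight thus lowers the right column. *)
Lemma row_flight (R : rcfType) (d : nat) (t c sg mu mu0 c0 : R)
    (al be ga de : {poly R}) :
  c != 0 -> t * c = 2 * sg ->
  (size al <= d.+1)%N -> (size be <= d.+1)%N ->
  (size ga <= d.+2)%N -> (size de <= d.+2)%N -> ga`_d.+1 != 0 ->
  al * de - be * ga = 1 ->
  ga * laxA sg mu + de * laxC c = laxC c0 * al - laxA sg mu0 * ga ->
  (size (be - t *: al)%R <= d)%N /\ (size (de - t *: ga)%R <= d.+1)%N.
Proof.
move=> cn0 tc sal sbe sga sde ga0 det /(congr1 (fun p : {poly R} => p`_(d.+3))).
have sal' : (size al <= d.+2)%N by rewrite (leq_trans sal).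
have e3 : (d.+3 = d.+1 + 2)%N by rewrite addn2.
rewrite !coefB coefD e3 [laxC c0 * _]mulrC [laxA sg mu0 * _]mulrC.
rewrite !(@coefM_top _ _ _ d.+1 2) ?size_laxA ?size_laxC //.
rewrite !coef_laxA2 !coef_laxC2 [al`__]nth_default // mul0r sub0r => eg.
have dE : de`_d.+1 = t * ga`_d.+1.
  apply: (mulIf cn0); rewrite mulrAC tc; move/eqP: eg; rewrite -subr_eq0.
  move/eqP=> eg; apply/eqP; rewrite -subr_eq0; apply/eqP.
  by rewrite -[RHS]oppr0 -[in RHS]eg; ring.
have bE : be`_d = t * al`_d.
  move/(congr1 (fun p : {poly R} => p`_(d + d.+1))): det.
  rewrite coefB !coefM_top // coef1 addnS /= dE => /eqP.
  rewrite mulrCA mulrA -mulrBl mulf_eq0 (negPf ga0) orbF subr_eq0.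
  by move/eqP.
split; apply: size_le_pred.
- exact: size_scale_sub.
- by rewrite coefB coefZ bE subrr.
- exact: size_scale_sub.
- by rewrite coefB coefZ dE subrr.
Qed.

(** The analogue for the left column: the lower right entry in degree [d + 2] yields the ratio [r],
    and the determinant in degree [2 d] carries it to the top row. *)
Lemma row_kick (R : rcfType) (d : nat) (r k sg mu mu0 c0 : R)
    (al be ga de : {poly R}) :
  sg != 0 -> r * k = - (2 * sg) ->
  (size al <= d.+1)%N -> (size be <= d)%N ->
  (size ga <= d.+2)%N -> (size de <= d.+1)%N -> ga`_d.+1 != 0 ->
  al * de - be * ga = 1 ->
  ga * laxB k - de * laxA (- sg) mu = laxC c0 * be - laxA sg mu0 * de ->
  [/\ de`_d != 0, (size (ga - r *: ('X * de))%R <= d.+1)%N &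
      (0 < d)%N -> (size (al - r *: ('X * be))%R <= d)%N].
Proof.
move=> sg0 rk sal sbe sga sde ga0 det /(congr1 (fun p : {poly R} => p`_(d.+2))).
have k0 : k != 0.
  apply: contraNneq sg0 => k0; move/eqP: rk; rewrite k0 mulr0 eq_sym oppr_eq0.
  by rewrite mulf_eq0 pnatr_eq0.
have sbe' : (size be <= d.+1)%N by rewrite (leq_trans sbe).
have e1 : (d.+2 = d.+1 + 1)%N by rewrite addn1.
have e2 : (d.+2 = d + 2)%N by rewrite addn2.
rewrite !coefB {1}e1 e2 [laxC c0 * _]mulrC [laxA sg mu0 * _]mulrC.
rewrite (@coefM_top _ _ _ d.+1 1) ?size_laxB //.
rewrite !(@coefM_top _ _ _ d 2) ?size_laxA ?size_laxC //.
rewrite !coef_laxA2 coef_laxC2 coef_laxB1 [be`__]nth_default // mul0r sub0r => eg.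
have gE : ga`_d.+1 = r * de`_d.
  apply: (mulIf k0); rewrite mulrAC rk; move/eqP: eg; rewrite -subr_eq0.
  move/eqP=> eg; apply/eqP; rewrite -subr_eq0; apply/eqP.
  by rewrite -[RHS]eg; ring.
have d0 : de`_d != 0 by apply: contraNneq ga0 => d0; rewrite gE d0 mulr0.
have sX (p : {poly R}) m : (size p <= m)%N -> (size ('X * p)%R <= m.+1)%N.
  move=> sp; rewrite mulrC; case: (eqVneq p 0) => [->|p0].
    by rewrite mul0r size_poly0.
  by rewrite size_mulX.
split => //.
- apply: size_le_pred; first by apply: size_scale_sub => //; apply: sX.
  by rewrite coefB coefZ coefXM /= gE subrr.
(* In degree [2 d] the coefficient of the determinant is 0 only for [d > 0]; for [d = 0] it is 1. *)
case: d => [//|d] in sal sbe sbe' sga sde ga0 e1 e2 eg gE d0 det * => _.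
apply: size_le_pred; first by apply: size_scale_sub => //; apply: sX.
rewrite coefB coefZ coefXM /=.
move/(congr1 (fun p : {poly R} => p`_(d.+1 + d.+1))): det.
rewrite coefB coefM_top // addSnnS coefM_top // coef1 addnS /= gE.
rewrite mulrA [_ * r]mulrC -mulrBl => /eqP; rewrite mulf_eq0 (negPf d0) orbF.
by move/eqP.
Qed.

(** A row times [M^-1] pairs with [M] times a column as before, and at [a^-1] and [b^-1] the matrix
    [M] moves the coordinates of the phase point. *)
Lemma row_back_pair (R : rcfType) (a b l : R) (s : (R * R) * (R * R))
    (u : {poly R} * {poly R}) :
  let s' := bounce a b l s in
  let w := row_back (flight a b l s.2) (kick a b l s'.1) u in
  w.1.[a^-1] * s'.1.1 + w.2.[a^-1] * s'.2.1 =
    u.1.[a^-1] * s.1.1 + u.2.[a^-1] * s.2.1 /\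
  w.1.[b^-1] * s'.1.2 + w.2.[b^-1] * s'.2.2 =
    u.1.[b^-1] * s.1.2 + u.2.[b^-1] * s.2.2.
Proof.
move=> s' w; rewrite /w /row_back /= -/(kick a b l s'.1).
rewrite !(hornerD, hornerN, hornerZ, hornerM, hornerX).
by split; ring.
Qed.

(** Each bounce divides [T] by [M] on the right and lowers its degree by one, so [d + 1] bounces
    exhaust it. [L0], given by [mu0] and [c0], stays fixed while [L] follows the orbit; the constant
    term of [top.1] survives because its corrections are multiples of ['X]. *)
Lemma descent (R : rcfType) (a b l mu0 c0 : R) (d : nat)
    (s s1 : (R * R) * (R * R)) (top bot : {poly R} * {poly R}) :
  s1 = iter d.+1 (bounce a b l) s ->
  0 < b -> b < a -> 0 < l -> phase a b l s ->
  let sg := Num.sqrt (a * b * l) in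
  let A := laxA sg (inner s) in let B := laxB (quad_pos a b s.1) in
  let C := laxC (quad_dir a b s.2) in
  (size top.1 <= d.+1)%N -> (size top.2 <= d.+1)%N ->
  (size bot.1 <= d.+2)%N -> (size bot.2 <= d.+2)%N -> bot.1`_d.+1 != 0 ->
  top.1 * bot.2 - top.2 * bot.1 = 1 -> top.1`_0 = 1 ->
  bot.1 * A + bot.2 * C = laxC c0 * top.1 - laxA sg mu0 * bot.1 ->
  bot.1 * B - bot.2 * A = laxC c0 * top.2 - laxA sg mu0 * bot.2 ->
  top.1.[a^-1] * s.1.1 + top.2.[a^-1] * s.2.1 =
    s1.1.1 /\
  top.1.[b^-1] * s.1.2 + top.2.[b^-1] * s.2.2 =
    s1.1.2.
Proof.
move=> es1 b0 ba l0; have a0 : 0 < a by apply: lt_trans ba.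
elim: d s top bot es1 => [|d IH] s [al be] [ga de] es1 ps sg A B C /=
  sal sbe sga sde ga0 det al1 eq1 eq2.
all: have [_ u1 _] := ps.
all: have [_ _ et er] := bounce_step b0 ba ps; rewrite -/sg in et er.
all: have [eA1 eB1 eA' eC'] := lax_step b0 ba ps.
all: rewrite -/sg -/A -/B -/C in eA1 eB1 eA' eC'.
all: set t := flight a b l s.2 in et eA1 eB1 eA' eC'.
all: set s' := bounce a b l s in er eA1 eB1 eA' eC'.
all: set r := kick a b l s'.1 in er eA' eC'.
all: have sg0 : sg != 0 by rewrite sqrtr_eq0 -ltNge !mulr_gt0.
all: have c_neq0 : quad_dir a b s.2 != 0 by rewrite gt_eqF ?quad_dir_gt0.
all: have [sbe1 sde1] := row_flight c_neq0 et sal sbe sga sde ga0 det eq1.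
all: set be1 := be - t *: al in sbe1; set de1 := de - t *: ga in sde1.
all: have [] := row_back_pair a b l s (al, be);
     rewrite /row_back /= -/s' -/t -/r -/be1 => <- <-.
(* For [d = 0], [be1] vanishes and [al] is the constant 1: the row [(1, 0)] reads off the vertex. *)
- have -> : s1 = s' by [].
  move: sbe1; rewrite leqn0 size_poly_eq0 => /eqP ->.
  rewrite mulr0 scaler0 subr0 (size1_polyC sal) al1.
  by rewrite !hornerC !mul0r !mul1r !addr0.
set A1 := laxA (- sg) _ in eA1 eA' eC'; set B1 := laxB _ in eB1 eA' eC'.
have det1 : al * de1 - be1 * ga = 1.
  by rewrite -det /de1 /be1 -!mul_polyC; ring.
have eq1' : ga * A1 + de1 * C = laxC c0 * al - laxA sg mu0 * ga.
  by rewrite -eq1 eA1 /de1 -!mul_polyC; ring.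
have eq2' : ga * B1 - de1 * A1 = laxC c0 * be1 - laxA sg mu0 * de1.
  transitivity (ga * B - de * A - t%:P * (ga * A + de * C)).
    by rewrite eA1 eB1 /de1 -!mul_polyC; ring.
  by rewrite eq1 eq2 /be1 /de1 -!mul_polyC; ring.
have [de10 sga2 /(_ isT) sal2] :=
  row_kick sg0 er sal sbe1 sga sde1 ga0 det1 eq2'.
set al2 := al - _ in sal2 *; set ga2 := ga - _ in sga2.
have ps' : phase a b l s' by apply: bounce_phase.
have [_ u1' _] := ps'.
have eq1'' : ga2 * laxA sg (inner s') + de1 * laxC (quad_dir a b s'.2) =
    laxC c0 * al2 - laxA sg mu0 * ga2.
  transitivity (ga * A1 + de1 * C - (r *: 'X) * (ga * B1 - de1 * A1)).
    by rewrite eA' eC' /ga2 -!mul_polyC; ring.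
  by rewrite eq1' eq2' /al2 /ga2 -!mul_polyC; ring.
have eq2'' : ga2 * B1 - de1 * laxA sg (inner s') =
    laxC c0 * be1 - laxA sg mu0 * de1.
  by rewrite -eq2' eA' /ga2 -!mul_polyC; ring.
apply: (IH s' (al2, be1) (ga2, de1)) => //=; first by rewrite es1 iterSr.
(* If the new top coefficient of [ga2] were 0, this degree of the lower left entry would make the
   product of [quad_dir] and the nonzero top coefficient of [de1] vanish. *)
- have := congr1 (fun p : {poly R} => p`_(d.+1 + 2)) eq1''.
  rewrite coefB coefD [laxC c0 * _]mulrC [laxA sg mu0 * _]mulrC.
  rewrite !(@coefM_top _ _ _ d.+1 2) ?size_laxA ?size_laxC // 1?leqW //.
  rewrite !coef_laxA2 !coef_laxC2 [al2`__]nth_default // mul0r sub0r.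
  move=> e; apply/eqP => ga20; move/eqP: e; rewrite ga20 !mul0r oppr0 add0r.
  by rewrite mulf_eq0 oppr_eq0 (negPf de10) gt_eqF ?quad_dir_gt0.
- by rewrite -det1 /al2 /ga2 -!mul_polyC; ring.
- by rewrite /al2 coefB coefZ coefXM mulr0 subr0.
Qed.

(** * Determinant and kernel of the Lax matrix, and closing of the orbit *)

(** Let [mu] and [h] be the components of [x] along [v] and across it. Tangency reads [c = l + h^2],
    which determines [k c] and [k + c] from [a], [b], [l], [sg], [mu]; the coefficients involve [k]
    and [c] only in this way. *)
Lemma lax_det (R : rcfType) (a b l : R) (s : (R * R) * (R * R)) :
  0 < a -> 0 < b -> 0 < l -> phase a b l s ->
  laxA (Num.sqrt (a * b * l)) (inner s) ^+ 2 +
    laxB (quad_pos a b s.1) * laxC (quad_dir a b s.2) =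
  (a * b * l) *:
    ('X * ('X - (a^-1)%:P) * ('X - (b^-1)%:P) * ('X - (l^-1)%:P)).
Proof.
move=> a0 b0 l0 [e1 e2 e3]; have := sqrt_abl_sqr a0 b0 l0.
move: (Num.sqrt _) e3 => sg e3 e4.
have [mu [h [ex ey]]] : exists mu h, s.1.1 = mu * s.2.1 - h * s.2.2 /\
    s.1.2 = mu * s.2.2 + h * s.2.1.
  exists (inner s), (s.1.2 * s.2.1 - s.1.1 * s.2.2); rewrite /inner; split.
    by rewrite -[LHS]mulr1 -e2; ring.
  by rewrite -[LHS]mulr1 -e2; ring.
rewrite /inner /quad_pos ex ey; rewrite ex ey in e1 e3; rewrite /quad_dir.
move: s.2.1 s.2.2 {ex ey} e1 e2 e3 => v1 v2 e1 e2 e3.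
have -> : (mu * v1 - h * v2) * v1 + (mu * v2 + h * v1) * v2 = mu.
  by rewrite -[RHS]mulr1 -e2; ring.
have -> : (mu * v1 - h * v2) ^+ 2 + (mu * v2 + h * v1) ^+ 2 = mu ^+ 2 + h ^+ 2.
  by rewrite -[RHS]mulr1 -e2; ring.
have v12 : v1 ^+ 2 = 1 - v2 ^+ 2 by rewrite -e2; ring.
set c := b * v1 ^+ 2 + a * v2 ^+ 2.
have c1 : c = l + h ^+ 2.
  have ab0 : a * b != 0 by rewrite mulf_neq0 ?gt_eqF.
  apply: (mulfI ab0); rewrite [RHS]mulrDr -e4 -[sg]opprK -e3 sqrrN.
  transitivity (c * (b * (mu * v1 - h * v2) ^+ 2 + a * (mu * v2 + h * v1) ^+ 2)).
    by rewrite e1; ring.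
  by rewrite /c; ring: v12.
have c2 : (a + b - (mu ^+ 2 + h ^+ 2)) * c = 2 * sg * mu + a * b + (a + b) * l.
  transitivity (2 * sg * mu + (b * (mu * v1 - h * v2) ^+ 2 +
      a * (mu * v2 + h * v1) ^+ 2) + (a + b) * (c - h ^+ 2)); last first.
    by rewrite e1 c1; ring.
  by rewrite -[sg]opprK -e3 /c; ring: v12.
have c3 : a + b - (mu ^+ 2 + h ^+ 2) + c = a + b + l - mu ^+ 2.
  by rewrite c1; ring.
move: (_ - (mu ^+ 2 + _)) c2 c3 => k; move: c {c1} => c c2 c3.
have inv (x : R) : 0 < x -> x%:P * (x^-1)%:P = 1 :> {poly R}.
  by move=> x0; rewrite -polyCM divff ?gt_eqF.
have := inv _ a0; have := inv _ b0; have := inv _ l0.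
move: (a^-1)%:P (b^-1)%:P (l^-1)%:P => ia ib il pl pb pa.
transitivity ((a * b * l)%:P * 'X^4 - (a * b + (a + b) * l)%:P * 'X^3 +
   (a + b + l)%:P * 'X^2 - 'X).
  rewrite -e4 /laxA /laxB /laxC -!mul_polyC.
  have := congr1 polyC c3; have := congr1 polyC c2.
  rewrite !(polyCD, polyCB, polyCM, polyCN, polyC_exp).
  move: k%:P c%:P => pk pc q2 q3.
  have q3' : pk = a%:P + b%:P + l%:P - mu%:P ^+ 2 - pc by rewrite -q3; ring.
  transitivity (sg%:P ^+ 2 * 'X^4 - (pk * pc - 2%:P * sg%:P * mu%:P) * 'X^3 +
    (pk + pc + mu%:P ^+ 2) * 'X^2 - 'X); first by ring.
  by rewrite q2 q3; ring.
rewrite -mul_polyC !(polyCD, polyCM); ring: pa pb pl.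
Qed.

(** At [a^-1] and [b^-1] the columns [(x_i, v_i)] are killed by [L]; its first row, which suffices
    for the vertex, reduces to the equation of the ellipse. *)
Lemma lax_eigen (R : rcfType) (a b l : R) (s : (R * R) * (R * R)) :
  0 < a -> 0 < b -> phase a b l s ->
  let A := laxA (Num.sqrt (a * b * l)) (inner s) in
  let B := laxB (quad_pos a b s.1) in
  A.[a^-1] * s.1.1 + B.[a^-1] * s.2.1 = 0 /\
  A.[b^-1] * s.1.2 + B.[b^-1] * s.2.2 = 0.
Proof.
move=> a0 b0 [e1 e2 e3] A B; rewrite /A /B /laxA /laxB /inner /quad_pos.
rewrite -[Num.sqrt _]opprK -e3 !(hornerD, hornerN, hornerZ, hornerXn, hornerX, hornerC).
move: s.1.1 s.1.2 s.2.1 s.2.2 {e2 e3} e1 => x1 x2 v1 v2 e1.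
have na : a != 0 by rewrite gt_eqF.
have nb : b != 0 by rewrite gt_eqF.
split.
- transitivity (v1 / a ^+ 2 * (a * b - (b * x1 ^+ 2 + a * x2 ^+ 2))).
    by field.
  by rewrite e1 subrr mulr0.
- transitivity (v2 / b ^+ 2 * (a * b - (b * x1 ^+ 2 + a * x2 ^+ 2))).
    by field.
  by rewrite e1 subrr mulr0.
Qed.

(** [T = P + Q L] commutes with [L] and has determinant 1, so [descent] applies with [L0 = L]. By
    [lax_eigen] its top row acts as [P = 1] on the initial coordinates. *)
Lemma iter_bounce_of_pell (R : rcfType) (a b l : R) (n : nat)
    (P W : {poly R}) (s : (R * R) * (R * R)) :
  0 < b -> b < a -> 0 < l -> (2 <= n)%N -> phase a b l s ->
  size P = n.+1 -> size W = n.-1 ->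
  P ^+ 2 - 1 =
    'X * ('X - (a^-1)%:P) * ('X - (b^-1)%:P) * ('X - (l^-1)%:P) * W ^+ 2 ->
  P.[0] = 1 -> P.[a^-1] = 1 -> P.[b^-1] = 1 ->
  (iter n (bounce a b l) s).1 = s.1.
Proof.
move=> b0 ba l0 n2 ps sP sW ePW P0 Pa Pb; have a0 : 0 < a by apply: lt_trans ba.
have [d nd] : exists d, n = d.+2 by exists (n - 2)%N; lia.
subst n; rewrite /= in sW.
set sg := Num.sqrt (a * b * l).
have sg2 : sg ^+ 2 = a * b * l by apply: sqrt_abl_sqr.
have sg0 : sg != 0 by rewrite sqrtr_eq0 -ltNge !mulr_gt0.
set D := 'X * _ * _ * _ in ePW.
have mD : D \is monic.
  by rewrite /D !monicMl ?monicX ?monicXsubC.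
have lP : P`_d.+2 = lead_coef P by rewrite lead_coefE sP.
have lW : W`_d = lead_coef W by rewrite lead_coefE sW.
have lW0 : W`_d != 0 by rewrite lW lead_coef_eq0 -size_poly_gt0 sW.
have lPW : P`_d.+2 ^+ 2 = W`_d ^+ 2.
  have sP2 : (size (P ^+ 2) = (d.+2 + d.+2).+1)%N.
    rewrite expr2 size_mul ?sP ?addSn ?addnS //; by rewrite -size_poly_gt0 sP.
  have : lead_coef (P ^+ 2 - 1) = lead_coef P ^+ 2.
    by rewrite lead_coefDl ?lead_coef_exp // size_polyN size_poly1 sP2.
  by rewrite ePW lead_coef_monicM // lead_coef_exp lP lW.
(* The size of [e] makes [det T = 1]; its sign cancels the top term of [P + Q A], as the degree
   bound on the top row requires. *)
pose e := - (P`_d.+2 / W`_d / sg); pose Q := e *: W.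
have e2 : e ^+ 2 * (a * b * l) = 1.
  rewrite /e sqrrN !exprMn lPW !exprVn -sg2.
  by rewrite divff ?sqrf_eq0 // mul1r mulVf // sqrf_eq0.
have e0 : e != 0.
  by apply: contra_eq_neq e2 => ->; rewrite expr0n mul0r eq_sym oner_eq0.
have sQ : size Q = d.+1 by rewrite size_scale.
set A := laxA sg (inner s); set B := laxB (quad_pos a b s.1).
set C := laxC (quad_dir a b s.2).
have dL : P ^+ 2 - Q ^+ 2 * (A ^+ 2 + B * C) = 1.
  rewrite lax_det // -/D.
  have -> : Q ^+ 2 * ((a * b * l) *: D) = P ^+ 2 - 1.
    rewrite ePW /Q exprZn -scalerAl -scalerAr scalerA e2 scale1r; ring.
  by ring.
have sMul (p q : {poly R}) i j :
    (size p <= i.+1)%N -> (size q <= j.+1)%N -> (size (p * q)%R <= (i + j).+1)%N.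
  move=> hp hq; rewrite (leq_trans (size_polyMleq _ _)) //; lia.
have sQA := sMul Q A d 2 (eq_leq sQ) (size_laxA _ _).
have sQB := sMul Q B d 1%N (eq_leq sQ) (size_laxB _).
have sQC := sMul Q C d 2 (eq_leq sQ) (size_laxC _).
have lQ : Q`_d = e * W`_d by rewrite coefZ.
have sPQA : (size (P + Q * A)%R <= d.+3)%N.
  by rewrite (leq_trans (size_polyD _ _)) // geq_max sP leqnn -addn2.
have sPQA' : (size (P - Q * A)%R <= d.+3)%N.
  by rewrite (leq_trans (size_polyD _ _)) // geq_max sP size_polyN leqnn -addn2.
have [_ u1 _] := ps.
have h := @descent R a b l (inner s) (quad_dir a b s.2) d.+1 s
  (iter d.+2 (bounce a b l) s) (P + Q * A, Q * B) (Q * C, P - Q * A)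
  (erefl _) b0 ba l0 ps.
rewrite [_.1]surjective_pairing [RHS]surjective_pairing.
case: h => /=.
- apply: size_le_pred => //.
  rewrite coefD -[in X in _ + X]addn2 coefM_top ?sQ ?size_laxA // lQ coef_laxA2.
  by rewrite /e; field; rewrite sg0 lW0.
- by rewrite -[d.+2]/(d.+1.+1) -addn1.
- by rewrite -addn2.
- by [].
- rewrite -addn2 coefM_top ?sQ ?size_laxC // lQ coef_laxC2.
  by rewrite mulrN oppr_eq0 !mulf_neq0 // gt_eqF // quad_dir_gt0.
- by rewrite -[RHS]dL; ring.
- by rewrite -horner_coef0 hornerD hornerM P0 [A.[0]]horner_coef0 !coefE /= !mulr0 addr0 mulr0 addr0.
- by rewrite -/sg -/A -/B -/C; ring.
- by rewrite -/sg -/A -/B -/C; ring.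
have [f1 f2] := lax_eigen a0 b0 ps.
rewrite -/sg -/A -/B in f1 f2.
move=> g1 g2; rewrite [(P + _).[_]]hornerD ![(Q * _).[_]]hornerM Pa in g1.
rewrite [(P + _).[_]]hornerD ![(Q * _).[_]]hornerM Pb in g2.
rewrite -g1 -g2; congr pair.
- transitivity (s.1.1 + Q.[a^-1] * (A.[a^-1] * s.1.1 + B.[a^-1] * s.2.1)).
    by ring.
  by rewrite f1 mulr0 addr0.
- transitivity (s.1.2 + Q.[b^-1] * (A.[b^-1] * s.1.2 + B.[b^-1] * s.2.2)).
    by ring.
  by rewrite f2 mulr0 addr0.
Qed.

(** * The transfer matrix of a periodic orbit *)

(* Left multiplication of a column by M. *)
Definition col_step (R : rcfType) (t r : R) (u : {poly R} * {poly R}) :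
    {poly R} * {poly R} :=
  let f := u.1 + t *: u.2 in (f, u.2 + r *: ('X * f)).

(** The product of the matrices [M] along the orbit, earliest bounce innermost, as an action on
    columns. *)
Fixpoint transfer (R : rcfType) (a b l : R) (k : nat) (s : (R * R) * (R * R))
    (u : {poly R} * {poly R}) : {poly R} * {poly R} :=
  if k is k'.+1 then
    let s' := bounce a b l s in
    transfer a b l k' s' (col_step (flight a b l s.2) (kick a b l s'.1) u)
  else u.

Definition lax_mul (R : rcfType) (a b l : R) (s : (R * R) * (R * R))
    (u : {poly R} * {poly R}) : {poly R} * {poly R} :=
  let A := laxA (Num.sqrt (a * b * l)) (inner s) in
  (A * u.1 + laxB (quad_pos a b s.1) * u.2,
   laxC (quad_dir a b s.2) * u.1 - A * u.2).

Lemma transfer_lin (R : rcfType) (a b l : R) (k : nat)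
    (s : (R * R) * (R * R)) (p q : {poly R}) (u w : {poly R} * {poly R}) :
  transfer a b l k s (p * u.1 + q * w.1, p * u.2 + q * w.2) =
  (p * (transfer a b l k s u).1 + q * (transfer a b l k s w).1,
   p * (transfer a b l k s u).2 + q * (transfer a b l k s w).2).
Proof.
elim: k s u w => [//|k IH] s u w.
rewrite [LHS]/= [in RHS]/= -IH; congr transfer.
by rewrite /col_step /= -!mul_polyC; congr pair; ring.
Qed.

Lemma transfer_lax (R : rcfType) (a b l : R) (k : nat)
    (s : (R * R) * (R * R)) (u : {poly R} * {poly R}) :
  0 < b -> b < a -> phase a b l s ->
  lax_mul a b l (iter k (bounce a b l) s) (transfer a b l k s u) =
  transfer a b l k s (lax_mul a b l s u).
Proof.
move=> b0 ba; elim: k s u => [//|k IH] s u ps.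
rewrite iterSr [transfer _ _ _ k.+1 _ u]/= IH ?[RHS]/=; last exact: bounce_phase.
congr transfer; have [eA1 eB1 eA' eC'] := lax_step b0 ba ps.
by rewrite /lax_mul /col_step eA' eC' eA1 eB1 /= -!mul_polyC; congr pair; ring.
Qed.

Lemma transfer_det (R : rcfType) (a b l : R) (k : nat)
    (s : (R * R) * (R * R)) (u w : {poly R} * {poly R}) :
  (transfer a b l k s u).1 * (transfer a b l k s w).2 -
    (transfer a b l k s w).1 * (transfer a b l k s u).2 =
  u.1 * w.2 - w.1 * u.2.
Proof.
elim: k s u w => [//|k IH] s u w; rewrite /= IH /= -!mul_polyC; ring.
Qed.

Lemma transfer_eval (R : rcfType) (a b l : R) (k : nat)
    (s : (R * R) * (R * R)) (u : {poly R} * {poly R}) :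
  (u.1.[a^-1] = s.1.1 -> u.2.[a^-1] = s.2.1 ->
    (transfer a b l k s u).1.[a^-1] = (iter k (bounce a b l) s).1.1 /\
    (transfer a b l k s u).2.[a^-1] = (iter k (bounce a b l) s).2.1) /\
  (u.1.[b^-1] = s.1.2 -> u.2.[b^-1] = s.2.2 ->
    (transfer a b l k s u).1.[b^-1] = (iter k (bounce a b l) s).1.2 /\
    (transfer a b l k s u).2.[b^-1] = (iter k (bounce a b l) s).2.2).
Proof.
elim: k s u => [//|k IH] s u; rewrite iterSr [transfer _ _ _ _ _ _]/=.
by split=> e1 e2; apply IH; rewrite /= !(hornerD, hornerZ, hornerM, hornerX)
   e1 e2 // [_^-1 * _]mulrC.
Qed.

(** At 0 each [M] is [[[1, t], [0, 1]]], so the product has diagonal 1 there; this yields [P.[0] =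
    1]. *)
Lemma transfer_eval0 (R : rcfType) (a b l : R) (k : nat)
    (s : (R * R) * (R * R)) (u : {poly R} * {poly R}) :
  (transfer a b l k s u).2.[0] = u.2.[0] /\
  (u.2.[0] = 0 -> (transfer a b l k s u).1.[0] = u.1.[0]).
Proof.
elim: k s u => [//|k IH] s u; rewrite /=.
set w := col_step _ _ u.
have e2 : w.2.[0] = u.2.[0].
  by rewrite /w /= !(hornerD, hornerZ, hornerM, hornerX) mul0r mulr0 addr0.
have [-> h] := IH (bounce a b l s) w; split=> // u0; rewrite h ?e2 //.
by rewrite /w /= hornerD hornerZ u0 mulr0 addr0.
Qed.

(** Neither [t] nor [r] vanishes and the second entry dominates, so no top term cancels. *)
Lemma size_transfer (R : rcfType) (a b l : R) (m k : nat)
    (s : (R * R) * (R * R)) (u : {poly R} * {poly R}) :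
  0 < b -> b < a -> 0 < l -> phase a b l s ->
  (size u.1 <= m)%N -> size u.2 = m.+1 ->
  (size (transfer a b l k s u).1 <= m + k)%N /\
  size (transfer a b l k s u).2 = (m + k).+1.
Proof.
move=> b0 ba l0; elim: k m s u => [|k IH] m s u ps s1 s2.
  by rewrite addn0.
have a0 : 0 < a by apply: lt_trans ba.
have [_ _ et er] := bounce_step b0 ba ps.
have sg0 : 2 * Num.sqrt (a * b * l) != 0.
  by rewrite mulf_neq0 ?pnatr_eq0 // sqrtr_eq0 -ltNge !mulr_gt0.
rewrite addnS -addSn /=; set s' := bounce a b l s in er *.
have t0 : flight a b l s.2 != 0.
  by apply: contraNneq sg0 => t0; rewrite -et t0 mul0r.
have r0 : kick a b l s'.1 != 0.
  by apply: contraNneq sg0 => r0; rewrite -oppr_eq0 -er r0 mul0r.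
have sf : size (u.1 + flight a b l s.2 *: u.2) = m.+1.
  by rewrite addrC size_polyDl size_scale ?s2.
have f0 : u.1 + flight a b l s.2 *: u.2 != 0 by rewrite -size_poly_gt0 sf.
apply: IH => /=; [exact: bounce_phase | by rewrite sf |].
by rewrite addrC size_polyDl size_scale // mulrC size_mulX // sf ?s2.
Qed.

(** On a closed orbit [T] commutes with [L]; as [B] and [C] are coprime, [T = P + Q L] with [P] half
    the trace. The two disjunctions provide nonzero vectors fixed by [T] at [a^-1] and [b^-1]. *)
Lemma pell_of_iter_bounce (R : rcfType) (a b l : R) (n : nat)
    (s : (R * R) * (R * R)) :
  0 < b -> b < a -> 0 < l -> (0 < n)%N -> phase a b l s ->
  quad_pos a b s.1 != quad_dir a b s.2 ->
  (s.1.1 != 0) || (s.2.1 != 0) -> (s.1.2 != 0) || (s.2.2 != 0) ->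
  iter n (bounce a b l) s = s ->
  exists P W : {poly R},
    [/\ size P = n.+1,
        P ^+ 2 - 1 = 'X * ('X - (a^-1)%:P) * ('X - (b^-1)%:P) *
          ('X - (l^-1)%:P) * W ^+ 2,
        P.[0] = 1 & P.[a^-1] = 1 /\ P.[b^-1] = 1].
Proof.
move=> b0 ba l0 n0 ps nek s1 s2 per; have a0 : 0 < a by apply: lt_trans ba.
pose e1 : {poly R} * {poly R} := (1, 0); pose e2 : {poly R} * {poly R} := (0, 1).
set sg := Num.sqrt (a * b * l).
set A := laxA sg (inner s); set B := laxB (quad_pos a b s.1).
set C := laxC (quad_dir a b s.2).
case eT1 : (transfer a b l n s e1) => [al ga].
case eT2 : (transfer a b l n s e2) => [be de].
have det : al * de - be * ga = 1.
  have := transfer_det a b l n s e1 e2; rewrite eT1 eT2 /= => ->; ring.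
have lin (p q : {poly R}) :
    transfer a b l n s (p, q) = (p * al + q * be, p * ga + q * de).
  have := transfer_lin a b l n s p q e1 e2; rewrite eT1 eT2 /= => <-.
  by rewrite !mulr1 !mulr0 addr0 add0r.
have := transfer_lax n e2 b0 ba ps; have := transfer_lax n e1 b0 ba ps.
rewrite per eT1 eT2 /lax_mul /= !lin -/sg -/A -/B -/C => -[q1 _] [q2 _].
have {q1} eBC : B * ga = be * C.
  apply: (addrI (A * al)); rewrite q1; ring.
have {q2} eAB : (al - de) * B = 2 * A * be.
  apply/eqP; rewrite -subr_eq0; apply/eqP.
  transitivity (((B * 1 - A * 0) * al + (C * 0 - A * 1) * be) - (A * be + B * de)).
    by ring.
  by rewrite q2; ring.
have k0 : 0 < quad_pos a b s.1 by case: ps => ? _ _; apply: quad_pos_gt0.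
have B0 : B != 0.
  apply/eqP => /(congr1 (fun p : {poly R} => p`_0)).
  by rewrite !coefE /= mulr0 sub0r => /eqP; rewrite oppr_eq0 oner_eq0.
have copBC : coprimep B C.
  have -> : B = quad_pos a b s.1 *: ('X - ((quad_pos a b s.1)^-1)%:P).
    by rewrite scalerBr -mul_polyC -[_ *: _%:P]mul_polyC -polyCM divff ?gt_eqF //
       mul_polyC.
  (* [B] vanishes only at [k^-1], where [C] is [(k - c) / k^2]; hence the assumption
     [quad_pos != quad_dir]. *)
  rewrite coprimepZl ?gt_eqF // coprimep_sym coprimep_XsubC rootE /C /laxC.
  rewrite !(hornerD, hornerN, hornerZ, hornerXn, hornerX).
  move: (quad_pos a b s.1) k0 nek => k k0 nek.
  have -> : - quad_dir a b s.2 * k^-1 ^+ 2 + k^-1 =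
      (k - quad_dir a b s.2) / k ^+ 2 by field; rewrite gt_eqF.
  by rewrite mulf_neq0 ?subr_eq0 // invr_eq0 expf_neq0 // gt_eqF.
have [Q eQ] : exists Q, be = Q * B.
  by exists (be %/ B); rewrite divpK // -(Gauss_dvdpl _ copBC) -eBC dvdp_mulr.
have eg : ga = Q * C by apply: (mulfI B0); rewrite eBC eQ; ring.
have ead : al - de = 2 * A * Q by apply: (mulIf B0); rewrite eAB eQ; ring.
pose h : {poly R} := (2^-1)%:P; pose P := h * (al + de).
have h2 : h * 2 = 1 by rewrite /h -polyC_natr -polyCM mulVf ?pnatr_eq0.
have eal : al = P + Q * A.
  transitivity (h * 2 * al); first by rewrite h2 mul1r.
  transitivity (P + h * (al - de)); first by rewrite /P; ring.
  by rewrite ead; transitivity (P + h * 2 * (Q * A)); [ring | rewrite h2 mul1r].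
have ede : de = P - Q * A.
  transitivity (al - 2 * A * Q); first by rewrite -ead; ring.
  by rewrite [in LHS]eal; ring.
(* As [det T = 1], [det (T - 1) = 2 - tr T]; a nonzero fixed vector makes it vanish. *)
have tr2 (z x v : R) : (x != 0) || (v != 0) ->
    al.[z] * x + be.[z] * v = x -> ga.[z] * x + de.[z] * v = v -> P.[z] = 1.
  move=> xv f1 f2; have := congr1 (horner^~ z) det.
  rewrite hornerD hornerN !hornerM hornerC => dz.
  rewrite [h.[z]]hornerC hornerD.
  have ex : (2 - (al.[z] + de.[z])) * x = 0.
    transitivity ((de.[z] - 1) * (al.[z] * x + be.[z] * v - x) - be.[z] *
      (ga.[z] * x + de.[z] * v - v) -
      (al.[z] * de.[z] - be.[z] * ga.[z] - 1) * x); first by ring.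
    by rewrite f1 f2 dz !subrr !mulr0 mul0r !subrr.
  have ev : (2 - (al.[z] + de.[z])) * v = 0.
    transitivity ((al.[z] - 1) * (ga.[z] * x + de.[z] * v - v) - ga.[z] *
      (al.[z] * x + be.[z] * v - x) -
      (al.[z] * de.[z] - be.[z] * ga.[z] - 1) * v); first by ring.
    by rewrite f1 f2 dz !subrr !mulr0 mul0r !subrr.
  have : 2 - (al.[z] + de.[z]) = 0.
    by case/orP: xv => /mulIf; apply; rewrite mul0r.
  by move/eqP; rewrite subr_eq0 => /eqP <-; rewrite mulVf ?pnatr_eq0.
have ev := transfer_eval a b l n s.
exists P, (sg *: Q); split.
(* [(1, 0)] does not fit [size_transfer], but after one bounce it is [(1, r X)], which does with
   [m = 1]. So [al] has degree below [n], and [de] degree exactly [n]. *)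
- have e1' : transfer a b l n s e1 = transfer a b l n.-1 (bounce a b l s)
      (col_step (flight a b l s.2) (kick a b l (bounce a b l s).1) e1).
    by case: (n) n0.
  have [_ _ _ er] := bounce_step b0 ba ps.
  have r0 : kick a b l (bounce a b l s).1 != 0.
    apply/eqP => r0; move/eqP: er; rewrite r0 mul0r eq_sym oppr_eq0 mulf_eq0.
    by rewrite pnatr_eq0 sqrtr_eq0 leNgt !mulr_gt0.
  set u := col_step _ _ _ in e1'.
  have u1 : u.1 = 1 by rewrite /u /= scaler0 addr0.
  have u2 : size u.2 = 2%N.
    rewrite /u /= scaler0 addr0 add0r size_scale // mulrC size_mulX ?oner_eq0 //.
    by rewrite size_poly1.
  have [|sal _] := size_transfer n.-1 b0 ba l0 (bounce_phase b0 ba ps) _ u2.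
    by rewrite u1 size_poly1.
  have [|_ sde] := @size_transfer _ a b l 0 n s e2 b0 ba l0 ps _ (size_poly1 _).
    by rewrite size_poly0.
  rewrite -e1' eT1 add1n prednK //= in sal; rewrite eT2 /= in sde.
  rewrite /P mul_polyC size_scale ?invr_eq0 ?pnatr_eq0 // addrC size_polyDl ?sde //.
- rewrite exprZn sqrt_abl_sqr // -scalerAr scalerAl -(lax_det a0 b0 l0 ps).
  rewrite -/sg -/A -/B -/C -[1 in LHS]det eal ede eQ eg; ring.
- have [d0 _] := transfer_eval0 a b l n s e2.
  have [_ a1] := transfer_eval0 a b l n s e1.
  rewrite eT2 /= hornerC in d0; rewrite eT1 /= !hornerC in a1.
  by rewrite [P.[0]]hornerM hornerD d0 a1 // hornerC mulVf // pnatr_eq0.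
- have [ea eb] := transfer_eval a b l n s (s.1.1%:P, s.2.1%:P).
  have [_ {}eb] := transfer_eval a b l n s (s.1.2%:P, s.2.2%:P).
  rewrite per lin /= !hornerC in ea; rewrite per lin /= !hornerC in eb.
  have [ea1 ea2] := ea erefl erefl; have [eb1 eb2] := eb erefl erefl.
  rewrite !(hornerD, hornerM, hornerC) in ea1 ea2 eb1 eb2.
  split; [apply: (tr2 _ s.1.1 s.2.1) | apply: (tr2 _ s.1.2 s.2.2)] => //.
  + by rewrite -[RHS]ea1; ring.
  + by rewrite -[RHS]ea2; ring.
  + by rewrite -[RHS]eb1; ring.
  + by rewrite -[RHS]eb2; ring.
Qed.

(** * Geometry of the trajectories *)

Lemma on_ellipseE (R : realType) (a b : R) (P : R * R) : 0 < a -> 0 < b ->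
  on_ellipse a b P <-> b * P.1 ^+ 2 + a * P.2 ^+ 2 = a * b.
Proof.
move=> a0 b0; rewrite /on_ellipse; have na := lt0r_neq0 a0.
have nb := lt0r_neq0 b0.
have ab0 : a * b != 0 by rewrite mulf_neq0.
have e : b * P.1 ^+ 2 + a * P.2 ^+ 2 = a * b * (P.1 ^+ 2 / a + P.2 ^+ 2 / b).
  by field; rewrite na nb.
split=> h; first by rewrite e h mulr1.
by apply: (mulfI ab0); rewrite -e h mulr1.
Qed.

Lemma unit_dirP (R : realType) (P Q : R * R) : P != Q ->
  exists d v, [/\ 0 < d, v.1 ^+ 2 + v.2 ^+ 2 = 1, unit_dir P Q = v,
    unit_dir Q P = (- v.1, - v.2) & Q = (P.1 + d * v.1, P.2 + d * v.2)].
Proof.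
case: P Q => [p1 p2] [q1 q2] nPQ.
pose D := (q1 - p1) ^+ 2 + (q2 - p2) ^+ 2.
have D0 : 0 < D.
  rewrite lt_def addr_ge0 ?sqr_ge0 // andbT; apply: contra nPQ.
  rewrite paddr_eq0 ?sqr_ge0 // !sqrf_eq0 !subr_eq0.
  by case/andP => /eqP -> /eqP ->.
have d0 : 0 < Num.sqrt D by rewrite sqrtr_gt0.
have nd := lt0r_neq0 d0.
have dD : Num.sqrt D ^+ 2 = D by rewrite sqr_sqrtr // ltW.
have e1 : dot ((q1, q2) - (p1, p2)) ((q1, q2) - (p1, p2)) = D.
  by rewrite /dot /= -!expr2.
have e2 : dot ((p1, p2) - (q1, q2)) ((p1, p2) - (q1, q2)) = D.
  by rewrite /dot /= /D; ring.
exists (Num.sqrt D), ((q1 - p1) / Num.sqrt D, (q2 - p2) / Num.sqrt D).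
rewrite /unit_dir e1 e2 /=; split => //.
- by rewrite !expr_div_n dD -mulrDl divff ?gt_eqF.
- by rewrite -!mulNr !opprB.
- by rewrite ![Num.sqrt D * _]mulrC !divfK // !subrKC.
Qed.

Lemma unit_dir_flight (R : realType) (x v : R * R) (t : R) :
  0 < t -> v.1 ^+ 2 + v.2 ^+ 2 = 1 ->
  unit_dir x (x.1 + t * v.1, x.2 + t * v.2) = v /\
  unit_dir (x.1 + t * v.1, x.2 + t * v.2) x = (- v.1, - v.2).
Proof.
case: x v => [x1 x2] [v1 v2] /= t0 e; have nt := lt0r_neq0 t0.
have st : Num.sqrt (t ^+ 2) = t by rewrite sqrtr_sqr gtr0_norm.
rewrite /unit_dir /dot /=.
have -> : (x1 + t * v1 - x1) * (x1 + t * v1 - x1) +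
   (x2 + t * v2 - x2) * (x2 + t * v2 - x2) = t ^+ 2.
  by rewrite -[RHS]mulr1 -e; ring.
have -> : (x1 - (x1 + t * v1)) * (x1 - (x1 + t * v1)) +
   (x2 - (x2 + t * v2)) * (x2 - (x2 + t * v2)) = t ^+ 2.
  by rewrite -[RHS]mulr1 -e; ring.
by rewrite st; split; congr pair; field.
Qed.

(** The dual conic: a line of normal [(v2, - v1)] and offset [h = x1 v2 - x2 v1] is tangent iff
    [(a - l) v2^2 + (b - l) v1^2 = h^2]. *)
Lemma tangent_to_confocalP (R : realType) (a b l d : R) (x v : R * R) :
  a - l != 0 -> b - l != 0 -> d != 0 -> v.1 ^+ 2 + v.2 ^+ 2 = 1 ->
  tangent_to_confocal a b l x (x.1 + d * v.1, x.2 + d * v.2) <->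
  quad_dir a b v - (x.1 * v.2 - x.2 * v.1) ^+ 2 = l.
Proof.
case: x v => [x1 x2] [v1 v2] /=; rewrite /quad_dir /= => al bl d0 e.
split; last first.
  (* The pole of the line, in homogeneous coordinates. *)
  move=> h; exists ((a - l) * v2), (- (b - l) * v1), (x1 * v2 - x2 * v1).
  have n0 : (v2 != 0) || (v1 != 0).
    rewrite -negb_and; apply/negP => /andP[/eqP v20 /eqP v10]; move/eqP: e.
    by rewrite v10 v20 expr0n addr0 eq_sym oner_eq0.
  split => /=.
  - rewrite !xpair_eqE !mulf_eq0 oppr_eq0 (negPf al) (negPf bl) /=.
    by case/orP: n0 => /negPf ->; rewrite ?andbF.
  - transitivity (b * v1 ^+ 2 + a * v2 ^+ 2 - l * (v1 ^+ 2 + v2 ^+ 2)).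
      by field; rewrite al bl.
    by rewrite e mulr1 -{1}h; ring.
  - by field; rewrite al bl.
  - by field; rewrite al bl.
case=> X [Y [Z [/= nz et e1 e2]]].
have [xi eX] : exists xi, X = xi * (a - l) by exists (X / (a - l)); rewrite divfK.
have [et' eY] : exists eta, Y = eta * (b - l) by exists (Y / (b - l)); rewrite divfK.
rewrite eX eY in nz et e1 e2.
have {}e1 : xi * x1 + et' * x2 = Z by rewrite -e1; field; rewrite al bl.
have {}e2 : xi * v1 + et' * v2 = 0.
  apply: (mulfI d0); rewrite mulr0 -[RHS](subrr Z) -{1}e2 -e1.
  by field; rewrite al bl.
(* Being orthogonal to [v], [(xi, et')] is [m] times the normal of the line. *)
pose m := xi * v2 - et' * v1.
have exi : xi = m * v2.
  rewrite -[LHS]mulr1 -e -[RHS]addr0 -[X in _ = _ + X](mulr0 v1) -e2 /m; ring.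
have eeta : et' = - m * v1.
  rewrite -[LHS]mulr1 -e -[RHS]addr0 -[X in _ = _ + X](mulr0 v2) -e2 /m; ring.
have m0 : m != 0.
  apply: contraNneq nz => m0; move: e1; rewrite exi eeta m0.
  by rewrite oppr0 !mul0r addr0 => <-.
have m20 : m ^+ 2 != 0 by rewrite sqrf_eq0.
apply/eqP; rewrite -subr_eq0; apply/eqP; apply: (mulfI m20); rewrite mulr0.
move: et; rewrite -e1 exi eeta => et.
transitivity ((m * v2 * (a - l)) ^+ 2 / (a - l) +
  (- m * v1 * (b - l)) ^+ 2 / (b - l) - (m * v2 * x1 + - m * v1 * x2) ^+ 2).
  rewrite -[l in _ - _ - l]mulr1 -e; by field; rewrite al bl.
by rewrite et subrr.
Qed.

(** Lagrange's identity; on the ellipse it translates tangency into the value [a b l] of the squared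
    integral. *)
Lemma joachimsthal (R : comPzRingType) (a b : R) (x v : R * R) :
  (b * x.1 * v.1 + a * x.2 * v.2) ^+ 2 + a * b * (x.1 * v.2 - x.2 * v.1) ^+ 2 =
  (b * x.1 ^+ 2 + a * x.2 ^+ 2) * (b * v.1 ^+ 2 + a * v.2 ^+ 2).
Proof. by ring. Qed.

Lemma mirror_kick (R : realType) (a b l : R) (x v : R * R) :
  0 < b -> b < a ->
  b * x.1 ^+ 2 + a * x.2 ^+ 2 = a * b ->
  b * x.1 * v.1 + a * x.2 * v.2 = Num.sqrt (a * b * l) ->
  mirror (ellipse_normal a b x) (- v.1, - v.2) =
  (v.1 + kick a b l x * (x.1 / a), v.2 + kick a b l x * (x.2 / b)).
Proof.
move=> b0 ba e1 e2; have a0 : 0 < a by apply: lt_trans ba.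
have na := lt0r_neq0 a0; have nb := lt0r_neq0 b0.
have k0 : quad_pos a b x != 0 by rewrite gt_eqF // quad_pos_gt0.
have ab0 : a * b != 0 by rewrite mulf_neq0.
have nn : dot (ellipse_normal a b x) (ellipse_normal a b x) =
    quad_pos a b x / (a * b).
  apply: (mulIf ab0); rewrite divfK // /dot /ellipse_normal /quad_pos /=.
  transitivity ((b * x.1 ^+ 2 + a * x.2 ^+ 2) * (a + b) / (a * b) -
    (x.1 ^+ 2 + x.2 ^+ 2)); first by field; rewrite na nb.
  by rewrite e1; field; rewrite na nb.
have vn : dot (- v.1, - v.2) (ellipse_normal a b x) =
    - (Num.sqrt (a * b * l) / (a * b)).
  by rewrite -e2 /dot /ellipse_normal /=; field; rewrite na nb.
have kE : 2 * dot (- v.1, - v.2) (ellipse_normal a b x) /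
    dot (ellipse_normal a b x) (ellipse_normal a b x) = kick a b l x.
  by rewrite nn vn /kick; field; rewrite na nb k0.
by rewrite /mirror kE /= !opprK addrC [X in (_, X)]addrC.
Qed.

(** A chord of length [d] has both ends on the ellipse, so twice Joachimsthal's integral is [- d c]:
    this selects the negative root and identifies the flight time with [d]. *)
Lemma phase_of_chord (R : realType) (a b l : R) (P Q : R * R) :
  0 < b -> b < a -> 0 < l -> a - l != 0 -> b - l != 0 ->
  on_ellipse a b P -> on_ellipse a b Q -> P != Q ->
  tangent_to_confocal a b l P Q ->
  phase a b l (P, unit_dir P Q) /\ (bounce a b l (P, unit_dir P Q)).1 = Q.
Proof.
move=> b0 ba l0 al bl; have a0 : 0 < a by apply: lt_trans ba.
move=> /(on_ellipseE _ a0 b0) eP /(on_ellipseE _ a0 b0) eQ /unit_dirP.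
move=> [d [v [d0 ev -> _ QE]]]; have nd := lt0r_neq0 d0.
rewrite QE => /(tangent_to_confocalP _ al bl nd ev) tan.
have c0 := quad_dir_gt0 b0 ba ev.
have eJ : 2 * (b * P.1 * v.1 + a * P.2 * v.2) = - (d * quad_dir a b v).
  apply: (mulfI nd); apply/eqP; rewrite -subr_eq0; apply/eqP.
  rewrite -(subrr (a * b)) -{1}eQ -eP QE /quad_dir /=; ring.
have J2 : (b * P.1 * v.1 + a * P.2 * v.2) ^+ 2 = a * b * l.
  rewrite -tan mulrBr -[X in X * quad_dir _ _ _]eP -joachimsthal; ring.
have J0 : b * P.1 * v.1 + a * P.2 * v.2 < 0.
  rewrite -(@pmulr_rlt0 _ 2) ?ltr0n //.
  by rewrite eJ oppr_lt0 mulr_gt0.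
have Js : Num.sqrt (a * b * l) = - (b * P.1 * v.1 + a * P.2 * v.2).
  by rewrite -J2 sqrtr_sqr ltr0_norm.
split; first by split => //=; rewrite Js opprK.
have -> : (bounce a b l (P, v)).1 =
  (P.1 + flight a b l v * v.1, P.2 + flight a b l v * v.2) by [].
by rewrite /flight Js mulrN eJ opprK mulfK ?gt_eqF.
Qed.

Lemma bounce_chord (R : realType) (a b l : R) (s : (R * R) * (R * R)) :
  0 < b -> b < a -> 0 < l -> phase a b l s ->
  [/\ s.1 != (bounce a b l s).1, unit_dir s.1 (bounce a b l s).1 = s.2 &
      mirror (ellipse_normal a b (bounce a b l s).1)
        (unit_dir (bounce a b l s).1 s.1) = (bounce a b l s).2].
Proof.
move=> b0 ba l0 ps; have a0 : 0 < a by apply: lt_trans ba.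
have [e1 e2 et er] := bounce_step b0 ba ps.
have [_ u1 _] := ps; have c0 := quad_dir_gt0 b0 ba u1.
have t0 : 0 < flight a b l s.2.
  by rewrite /flight divr_gt0 // mulr_gt0 ?sqrtr_gt0 ?mulr_gt0.
have [f1 f2] := unit_dir_flight s.1 t0 u1.
have n0 : (s.2.1 != 0) || (s.2.2 != 0).
  rewrite -negb_and; apply/negP => /andP[/eqP v10 /eqP v20]; move/eqP: u1.
  by rewrite v10 v20 expr0n addr0 eq_sym oner_eq0.
split => //; last by rewrite [unit_dir _ _]f2; apply: mirror_kick.
rewrite [s.1]surjective_pairing xpair_eqE /=.
move: (flight a b l s.2) t0 {et f1 f2} => t t0.
rewrite -[X in X == _]addr0 -[X in _ && (X == _)]addr0.
rewrite !(inj_eq (addrI _)) ![0 == _]eq_sym !mulf_eq0 (gt_eqF t0) /=.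
by rewrite negb_and.
Qed.

(** [Negz m] is [- (m + 1)], whence [m.+1] backward steps. *)
Definition orbit (R : rcfType) (a b l : R) (s : (R * R) * (R * R)) (k : int) :
    (R * R) * (R * R) :=
  match k with
  | Posz m => iter m (bounce a b l) s
  | Negz m => iter m.+1 (unbounce a b l) s
  end.

Lemma orbitS (R : rcfType) (a b l : R) (s : (R * R) * (R * R)) (k : int) :
  orbit a b l s (k + 1) = bounce a b l (orbit a b l s k).
Proof.
case: k => [m|m]; first by rewrite -PoszD addn1.
case: m => [|m]; first by rewrite /= unbounceK.
have -> : Negz m.+1 + 1 = Negz m by rewrite !NegzE -[m.+2]addn1 PoszD; ring.
by rewrite [orbit _ _ _ _ (Negz m.+1)]/= unbounceK.
Qed.

Lemma orbit_phase (R : rcfType) (a b l : R) (s : (R * R) * (R * R)) (k : int) :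
  0 < b -> b < a -> phase a b l s -> phase a b l (orbit a b l s k).
Proof.
move=> b0 ba ps; case: k => m; rewrite [orbit _ _ _ _ _]/=.
  by elim: m => // m IH; apply: bounce_phase.
apply: unbounce_phase => //.
by elim: m => // m IH; apply: unbounce_phase.
Qed.

Lemma orbit_billiard (R : realType) (a b l : R) (s : (R * R) * (R * R)) :
  0 < b -> b < a -> 0 < l -> a - l != 0 -> b - l != 0 -> phase a b l s ->
  let P k := (orbit a b l s k).1 in
  billiard_trajectory a b P /\ has_caustic a b l P.
Proof.
move=> b0 ba l0 al bl ps P; have a0 : 0 < a by apply: lt_trans ba.
have ph k : phase a b l (orbit a b l s k) by apply: orbit_phase.
split; first split.
- by move=> k; apply/on_ellipseE => //; have [] := ph k.
- by move=> k; rewrite /P orbitS; have [] := bounce_chord b0 ba l0 (ph k).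
- move=> k; have {k} [j ->] : exists j, k = j + 1 by exists (k - 1); rewrite subrK.
  rewrite /reflects_at /P addrK (orbitS _ _ _ _ (j + 1)).
  have [_ -> _] := bounce_chord b0 ba l0 (ph (j + 1)).
  by rewrite orbitS; have [_ _ ->] := bounce_chord b0 ba l0 (ph j).
- move=> k; rewrite /P orbitS; have [e1 u1 e3] := ph k.
  have t0 : flight a b l (orbit a b l s k).2 != 0.
    by rewrite gt_eqF // divr_gt0 ?quad_dir_gt0 // mulr_gt0 ?sqrtr_gt0 ?mulr_gt0.
  apply/(tangent_to_confocalP _ al bl t0 u1).
  have ab0 : a * b != 0 by rewrite mulf_neq0 ?gt_eqF.
  apply: (mulfI ab0); rewrite mulrBr -[X in X * quad_dir _ _ _]e1 -joachimsthal.
  by rewrite e3 sqrrN sqrt_abl_sqr // addrK.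
Qed.

(** A launch from an end of the minor axis, so that trajectories with the given caustic exist. *)
Lemma phase_top (R : rcfType) (a b l : R) :
  0 < b -> b < a -> 0 < l -> l < a ->
  phase a b l ((0, Num.sqrt b), (Num.sqrt (1 - l / a), - Num.sqrt (l / a))).
Proof.
move=> b0 ba l0 la; have a0 : 0 < a by apply: lt_trans ba.
have la1 : l / a < 1 by rewrite ltr_pdivrMr // mul1r.
have la0 : 0 < l / a by rewrite divr_gt0.
split => /=.
- by rewrite expr0n mulr0 add0r sqr_sqrtr // ltW.
- by rewrite sqrrN !sqr_sqrtr ?subrK // ?subr_ge0 ltW.
rewrite mulr0 mul0r add0r mulrN; congr (- _).
rewrite -{1}(gtr0_norm a0) -sqrtr_sqr -!sqrtrM ?mulr_ge0 ?sqr_ge0 ?ltW //.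
by congr Num.sqrt; field; rewrite gt_eqF.
Qed.

Theorem theorem3p1 (R : realType) (a b l0 : R) (n : nat) :
  0 < b -> b < a ->
  (0 < l0 /\ l0 < b) \/ (b < l0 /\ l0 < a) ->
  (3 <= n)%N ->
  (forall P : int -> R * R,
     billiard_trajectory a b P -> has_caustic a b l0 P ->
     periodic_trajectory n P)
  <->
  (exists p q : {poly R},
     (forall m : nat, n = (2 * m)%N ->
        [/\ size p = m.+1,
            size q = (m - 2).+1 &
            p ^+ 2
            - 'X * ('X - (a^-1)%:P) * ('X - (b^-1)%:P) * ('X - (l0^-1)%:P)
              * q ^+ 2 = 1])
     /\
     (forall m : nat, n = (2 * m + 1)%N ->
        [/\ size p = m.+1,
            size q = (m - 1).+1 &
            ('X - (l0^-1)%:P) * p ^+ 2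
            - 'X * ('X - (a^-1)%:P) * ('X - (b^-1)%:P) * q ^+ 2 = -1])).
Proof.
move=> b0 ba hl n3; have a0 : 0 < a by apply: lt_trans ba.
have [lp la bl] : [/\ 0 < l0, l0 < a & b - l0 != 0].
  case: hl => -[h1 h2]; split => //.
  - exact: lt_trans ba.
  - by rewrite subr_eq0 gt_eqF.
  - exact: lt_trans h1.
  - by rewrite subr_eq0 lt_eqF.
have al : a - l0 != 0 by rewrite subr_eq0 gt_eqF.
split=> [per | [p [q [hev hodd]]] P [onP neP refP] causP k].
  have ps := phase_top b0 ba lp la; set s := (_, _) in ps.
  have [bil caus] := orbit_billiard b0 ba lp al bl ps.
  have {}per := per _ bil caus.
  have ph k : phase a b l0 (orbit a b l0 s k) by apply: orbit_phase.
  (* Periodicity at the indices 0 and 1 restores the first chord, hence also its direction. *)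
  have it : iter n (bounce a b l0) s = s.
    have e0 := per 0; rewrite add0r in e0.
    have e1 := per 1; rewrite addrC orbitS -[1]add0r orbitS in e1.
    have [_ d0 _] := bounce_chord b0 ba lp (ph 0).
    have [_ dn _] := bounce_chord b0 ba lp (ph n%:Z).
    rewrite -[LHS]/(orbit a b l0 s n%:Z) -[RHS]/(orbit a b l0 s 0).
    rewrite [LHS]surjective_pairing [RHS]surjective_pairing -d0 -dn.
    by rewrite e0 e1.
  have [||||P [W [sP ePW P0 [Pa Pb]]]] := pell_of_iter_bounce b0 ba lp _ ps _ _ _ it.
  - exact: leq_trans n3.
  (* At this point [quad_pos - quad_dir] is [(a - b) (a - l0) / a], which is nonzero. *)
  - have la1 : l0 / a < 1 by rewrite ltr_pdivrMr // mul1r.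
    rewrite /quad_pos /quad_dir /= sqrrN !sqr_sqrtr ?subr_ge0 ?divr_ge0 ?ltW //.
    rewrite -subr_eq0 expr0n add0r.
    have -> : a + b - b - (b * (1 - l0 / a) + a * (l0 / a)) =
       (a - b) * (a - l0) / a by field; rewrite gt_eqF.
    by rewrite !mulf_neq0 ?invr_eq0 ?gt_eqF // subr_gt0.
  - by rewrite /= orbC sqrtr_eq0 -ltNge subr_gt0 ltr_pdivrMr // mul1r la.
  - by rewrite /= sqrtr_eq0 -ltNge b0.
  apply: (pell_half _ _ _ _ n3 sP ePW P0 Pa Pb); rewrite ?invr_gt0 //.
  by rewrite (inj_eq invr_inj) gt_eqF.
have [P' [W [sP sW ePW P0 [Pa Pb]]]] := pell_double n3 hev hodd.
(* With chord directions as velocities, any trajectory with the caustic becomes an orbit of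
   [bounce]. *)
pose st j := (P j, unit_dir (P j) (P (j + 1))).
have stP j : phase a b l0 (st j) /\ (bounce a b l0 (st j)).1 = P (j + 1).
  exact: phase_of_chord.
have stS j : st (j + 1) = bounce a b l0 (st j).
  have [ph pj] := stP j.
  have [_ _ m] := bounce_chord b0 ba lp ph.
  rewrite [RHS]surjective_pairing -m pj; congr pair.
  by have := refP (j + 1); rewrite /reflects_at addrK.
have stn m : st (k + m%:Z) = iter m (bounce a b l0) (st k).
  elim: m => [|m IH]; first by rewrite addr0.
  by rewrite iterS -IH -stS -addn1 PoszD addrA.
transitivity (st (k + n%:Z)).1; first by [].
rewrite stn; have [ph _] := stP k.
by apply: (iter_bounce_of_pell b0 ba lp _ ph sP sW ePW P0 Pa Pb); apply: leq_trans n3.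
Qed.
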